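(* Let $M$ be a $p$-adic analytic manifold and $A$ a Weil algebra over $\mathbb{Q}_p$. Suppose a Lie group $G$ acts analytically on $M$. Then the action of $G$ can be lifted to an action on the Weil bundle $M^A$ such that the projection $\pi_M:M^A\to M$ is $G$-equivariant.
   Context: A Weil algebra over $\mathbb{Q}_p$ is a finite-dimensional commutative associative unital $\mathbb{Q}_p$-algebra $A=\mathbb{Q}_p\oplus\mathfrak{A}$ with $\mathfrak{A}$ its nilpotent maximal ideal; $pr:A\to\mathbb{Q}_p$ the projection. An infinitely near point of type $A$ to $x\in M$ is a $\mathbb{Q}_p$-algebra homomorphism $\xi:\mathcal{O}(U)\to A$ ($U$ open neighbourhood of $x$, $\mathcal{O}(U)$ analytic functions) with $pr\circ\xi=ev_x$. The Weil bundle $M^A$ is the set of such points with projection $\pi_M:M^A\to M$ to the base point; it is a $p$-adic analytic manifold with local coordinates $x_{k,j}$ given by $\xi(x_k)=\sum_j x_{k,j}(\xi)\alpha_j$ for a basis $\alpha_1=1,\dots,\alpha_l$ of $A$. *)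

(* Defs.v *)
From HB Require Import structures.
From mathcomp Require Import all_boot all_order all_algebra all_field.
From mathcomp Require Import boolp classical_sets.
From Stdlib Require Import Relation_Operators.

Set Implicit Arguments.
Unset Strict Implicit.
Unset Printing Implicit Defensive.

Import Order.TTheory GRing.Theory Num.Theory.
Local Open Scope ring_scope.
Local Open Scope classical_set_scope.

(** * The field of p-adic numbers *)

Definition padic_abs (p : nat) (q : rat) : rat :=
  if q == 0 then 0
  else p%:Q ^ ((logn p `|denq q|)%:Z - (logn p `|numq q|)%:Z).

(* Q_p is the completion of Q for padic_abs p; it is unique up to a unique    *)
(* isometric isomorphism. Its absolute value takes rational values.           *)
Record is_padic_completion (p : nat) (K : fieldType) (nu : K -> rat) : Prop := {
  nu_ge0 : forall x, 0 <= nu x;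
  nu_eq0 : forall x, nu x = 0 <-> x = 0;
  nuM : forall x y, nu (x * y) = nu x * nu y;
  nuD_max : forall x y, nu (x + y) <= Num.max (nu x) (nu y);
  nu_rat : forall q : rat, nu (ratr q) = padic_abs p q;
  nu_dense : forall x (e : rat), 0 < e -> exists q : rat, nu (x - ratr q) < e;
  nu_complete : forall u : nat -> K,
    (forall e : rat, 0 < e ->
       exists N, forall i j, (N <= i)%N -> (N <= j)%N -> nu (u i - u j) < e) ->
    exists l, forall e : rat, 0 < e ->
       exists N, forall i, (N <= i)%N -> nu (u i - l) < e }.

Record padicField (p : nat) := PadicField {
  Qp_field :> fieldType;
  Qp_abs : Qp_field -> rat;
  Qp_axiom : is_padic_completion p Qp_abs }.

(** * Analytic functions on K^n *)

Section LocalAnalysis.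
Variables (p : nat) (K : padicField p).
Implicit Types n : nat.

Definition cball n (x : 'rV[K]_n) (r : rat) : set 'rV[K]_n :=
  [set y | forall i, Qp_abs (y 0 i - x 0 i) <= r].

Definition open_rV n (U : set 'rV[K]_n) : Prop :=
  forall x, U x -> exists2 r : rat, 0 < r & cball x r `<=` U.

Definition mdeg n (a : 'I_n -> nat) : nat := (\sum_i a i)%N.

Definition monom n (z : 'rV[K]_n) (a : 'I_n -> nat) : K := \prod_i z 0 i ^+ a i.

(* c_a r^|a| -> 0, i.e. the power series converges on the closed ball of      *)
(* radius r.                                                                  *)
Definition ps_converges n (c : ('I_n -> nat) -> K) (r : rat) : Prop :=
  forall e : rat, 0 < e ->
    exists N, forall a, (N <= mdeg a)%N -> Qp_abs (c a) * r ^+ mdeg a < e.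

(* Multi-indices with all entries < N are indexed by {ffun 'I_n -> 'I_N}.     *)
Definition ps_partial n (c : ('I_n -> nat) -> K) (z : 'rV[K]_n) (N : nat) : K :=
  \sum_(a : {ffun 'I_n -> 'I_N})
     c (fun i => nat_of_ord (a i)) * monom z (fun i => nat_of_ord (a i)).

Definition ps_sum n (c : ('I_n -> nat) -> K) (z : 'rV[K]_n) (s : K) : Prop :=
  forall e : rat, 0 < e ->
    exists N, forall k, (N <= k)%N -> Qp_abs (ps_partial c z k - s) < e.

Definition analytic_at n (F : 'rV[K]_n -> K) (x : 'rV[K]_n) : Prop :=
  exists r : rat, exists c : ('I_n -> nat) -> K,
    [/\ 0 < r, ps_converges c r &
        forall y, cball x r y -> ps_sum c (y - x) (F y)].

End LocalAnalysis.

(** * Analytic manifolds *)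

(* The values of cmap outside cdom are irrelevant. Charts of one atlas may    *)
(* have different dimensions.                                                 *)
Record chart (p : nat) (K : padicField p) (M : Type) := Chart {
  cdim : nat;
  cdom : set M;
  cmap : M -> 'rV[K]_cdim }.

Definition atlas (p : nat) (K : padicField p) (M : Type) := set (chart K M).

Section Manifolds.
Variables (p : nat) (K : padicField p).

(* The topology of a manifold is the one defined by its atlas.                *)
Definition mopen (M : Type) (AM : atlas K M) (W : set M) : Prop :=
  forall c, AM c -> open_rV (@cmap _ _ _ c @` (cdom c `&` W)).

(* For f defined on the open set W: the map F = f o c^-1, defined near        *)
(* cmap c x, is analytic at cmap c x.                                         *)
Definition analytic_in_chart (M : Type) (c : chart K M) (W : set M)
    (f : M -> K) (x : M) : Prop :=
  exists2 F : 'rV[K]_(cdim c) -> K,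
    forall y, cdom c y -> W y -> f y = F (cmap c y) & analytic_at F (cmap c x).

Record is_manifold (M : Type) (AM : atlas K M) : Prop := {
  mfd_cover : forall x, exists2 c, AM c & cdom c x;
  mfd_inj : forall c x y, AM c -> cdom c x -> cdom c y ->
    cmap c x = cmap c y -> x = y;
  mfd_open : forall c d, AM c -> AM d ->
    open_rV (@cmap _ _ _ c @` (cdom c `&` cdom d));
  mfd_transition : forall c d x, AM c -> AM d -> cdom c x -> cdom d x ->
    forall j, analytic_in_chart c (cdom d) (fun y => cmap d y 0 j) x;
  mfd_hausdorff : forall x y, x <> y -> exists U V,
    [/\ mopen AM U, mopen AM V, U x, V y & U `&` V = set0] }.

(* f is in O(U); only the values of f on U matter.                            *)
Definition analytic_on (M : Type) (AM : atlas K M) (U : set M) (f : M -> K)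
    : Prop :=
  forall c x, AM c -> cdom c x -> U x -> analytic_in_chart c U f x.

Definition mcontinuous (M N : Type) (AM : atlas K M) (AN : atlas K N)
    (F : M -> N) : Prop :=
  forall W, mopen AN W -> mopen AM (F @^-1` W).

Definition analytic_map (M N : Type) (AM : atlas K M) (AN : atlas K N)
    (F : M -> N) : Prop :=
  mcontinuous AM AN F /\
  forall c d x, AM c -> AN d -> cdom c x -> cdom d (F x) ->
    forall j,
      analytic_in_chart c (F @^-1` cdom d) (fun y => cmap d (F y) 0 j) x.

Definition prod_chart (M N : Type) (c : chart K M) (d : chart K N)
    : chart K (M * N) :=
  @Chart _ K (M * N) (cdim c + cdim d) (cdom c `*` cdom d)
    (fun z => row_mx (cmap c z.1) (cmap d z.2)).

Definition prod_atlas (M N : Type) (AM : atlas K M) (AN : atlas K N)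
    : atlas K (M * N) :=
  [set e | exists c d, [/\ AM c, AN d & e = prod_chart c d]].

Record is_lie_group (G : groupType) (AG : atlas K G) : Prop := {
  lie_manifold : is_manifold AG;
  lie_mul : analytic_map (prod_atlas AG AG) AG (fun z : G * G => z.1 * z.2)%g;
  lie_inv : analytic_map AG AG (fun g : G => g^-1)%g }.

Record is_analytic_action (G : groupType) (AG : atlas K G) (M : Type)
    (AM : atlas K M) (act : G -> M -> M) : Prop := {
  act_1 : forall x, act 1%g x = x;
  act_M : forall g h x, act (g * h)%g x = act g (act h x);
  act_analytic :
    analytic_map (prod_atlas AG AM) AM (fun z : G * M => act z.1 z.2) }.

End Manifolds.

(** * Weil algebras *)

Record weilAlgebra (K : fieldType) := WeilAlgebra {
  wa_alg :> falgType K;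
  wa_ideal : {vspace wa_alg};
  wa_comm : forall a b : wa_alg, a * b = b * a;
  wa_idealP : forall a b : wa_alg, b \in wa_ideal -> a * b \in wa_ideal;
  wa_nilp : exists N, (wa_ideal ^+ N)%VS = 0%VS;
  wa_direct : directv (1 + wa_ideal)%VS;
  wa_full : (1 + wa_ideal)%VS = fullv }.

Definition wa_pr (K : fieldType) (A : weilAlgebra K) (a : A) : K :=
  coord [tuple (1 : A)] ord0 (daddv_pi 1%VS (wa_ideal A) a).

Lemma wa_cap0 (K : fieldType) (A : weilAlgebra K) :
  (1 :&: wa_ideal A = 0)%VS.
Proof. by apply/directv_addP; apply: wa_direct. Qed.

Lemma wa_prP (K : fieldType) (A : weilAlgebra K) (a : A) :
  a - (wa_pr a)%:A \in wa_ideal A.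
Proof.
have aE : a \in (1 + wa_ideal A)%VS by rewrite wa_full memvf.
suff -> : (wa_pr a)%:A = daddv_pi 1%VS (wa_ideal A) a.
  by rewrite -{1}(daddv_pi_add (wa_cap0 A) aE) addrC addKr memv_pi.
rewrite /wa_pr; have := memv_pi 1%VS (wa_ideal A) a.
move=> /vlineP [k ->].
have fr : free [tuple (1 : A)] by rewrite seq1_free oner_neq0.
by rewrite linearZ /= -[X in coord _ _ X]/([tuple (1 : A)]`_(@ord0 0))
   coord_free // eqxx mulr1.
Qed.

(** * Infinitely near points and the Weil bundle *)

Section WeilBundle.
Variables (p : nat) (K : padicField p) (M : Type) (AM : atlas K M).
Variable A : weilAlgebra K.

(* xi is a K-algebra morphism O(U) -> A with wa_pr o xi = ev_x. Elements of   *)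
(* O(U) are total functions, identified when they agree on U.                 *)
Record is_near_point (x : M) (U : set M) (xi : (M -> K) -> A) : Prop := {
  np_open : mopen AM U;
  np_mem : U x;
  np_ext : forall f g, analytic_on AM U f -> analytic_on AM U g ->
    (forall y, U y -> f y = g y) -> xi f = xi g;
  np_one : xi (fun=> 1) = 1;
  np_add : forall f g, analytic_on AM U f -> analytic_on AM U g ->
    xi (fun y => f y + g y) = xi f + xi g;
  np_scale : forall (k : K) f, analytic_on AM U f ->
    xi (fun y => k * f y) = k *: xi f;
  np_mul : forall f g, analytic_on AM U f -> analytic_on AM U g ->
    xi (fun y => f y * g y) = xi f * xi g;
  np_ev : forall f, analytic_on AM U f -> wa_pr (xi f) = f x }.

Record near_point := NearPoint {
  np_base : M;
  np_dom : set M;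
  np_hom : (M -> K) -> A;
  np_axiom : is_near_point np_base np_dom np_hom }.

(* np_hom xi is the composite of the restriction map                          *)
(* O(np_dom xi) -> O(np_dom zeta) with np_hom zeta.                           *)
Definition np_induced (xi zeta : near_point) : Prop :=
  [/\ np_base xi = np_base zeta, np_dom zeta `<=` np_dom xi &
      forall f, analytic_on AM (np_dom xi) f -> np_hom xi f = np_hom zeta f].

(* The neighbourhood U on which an infinitely near point is defined is        *)
(* immaterial: a point on a smaller neighbourhood is identified with the one  *)
(* it induces on a larger neighbourhood.                                      *)
Definition np_equiv : near_point -> near_point -> Prop :=
  clos_refl_sym_trans near_point np_induced.

Record weil_bundle := WeilBundle {
  wb_class : set near_point;
  wb_classP : exists xi, wb_class = [set zeta | np_equiv xi zeta] }.

Definition wb_of (xi : near_point) : weil_bundle :=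
  WeilBundle (ex_intro _ xi erefl).

Definition wb_proj (X : weil_bundle) : M := np_base (projT1 (cid (wb_classP X))).

Lemma np_equiv_base xi zeta : np_equiv xi zeta -> np_base xi = np_base zeta.
Proof. by elim=> [? ? []|||? ? ? _ -> _ ->]. Qed.

Lemma wb_projE (X : weil_bundle) xi : wb_class X xi -> wb_proj X = np_base xi.
Proof.
rewrite /wb_proj; case: (cid _) => zeta /= ->; exact: np_equiv_base.
Qed.

Lemma wb_proj_of xi : wb_proj (wb_of xi) = np_base xi.
Proof. by apply: wb_projE; apply: rst_refl. Qed.

Variable alpha : (\dim (fullv : {vspace A})).-tuple A.

(* The coordinates x_(k,j)(X), defined by                                     *)
(* xi(x_k) = \sum_j x_(k,j)(X) alpha_j for any representative xi of X on some *)
(* U contained in the domain of the chart c with coordinate functions x_k.    *)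
Definition wb_coord (c : chart K M) (X : weil_bundle)
    : 'M[K]_(cdim c, \dim (fullv : {vspace A})) :=
  xget 0 [set v : 'M[K]_(cdim c, \dim (fullv : {vspace A})) | exists xi, [/\ wb_class X xi, np_dom xi `<=` cdom c &
    forall k, np_hom xi (fun y => cmap c y 0 k) = \sum_j v k j *: tnth alpha j]].

Definition weil_chart (c : chart K M) : chart K weil_bundle :=
  @Chart _ K weil_bundle _ (wb_proj @^-1` cdom c)
    (fun X => mxvec (wb_coord c X)).

Definition weil_atlas : atlas K weil_bundle := weil_chart @` AM.

End WeilBundle.

Arguments wb_coord {p K M} AM {A} alpha c X.
Arguments weil_chart {p K M} AM {A} alpha c.
Arguments weil_atlas {p K M} AM {A} alpha.

(* Main.v *)
Require Import Defs.
From HB Require Import structures.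
From mathcomp Require Import all_boot all_order all_algebra all_field.
From mathcomp Require Import boolp classical_sets.
From mathcomp Require Import ring lra zify.
From Stdlib Require Import Relation_Operators.

(** A near point of type [A] at [x] is determined by its values on the
    coordinates of a chart. Since closed balls of K^n are compact and the
    manifold is Hausdorff, small chart balls [V] are open and closed, so their
    indicator functions are analytic; such an indicator is sent to an
    idempotent of [A] lying over 1, that is, to 1. Hence the near point only
    sees the function [f] on [V], where [f] is its Taylor polynomial of large
    order plus multiples of the N-th powers of the coordinates centred at [x],
    which are killed because the ideal of [A] is nilpotent. The near point is
    therefore [f |-> sum_a D_a f(x) Y^a] (Hasse derivatives [D_a]) with [Y] the
    values on the centred coordinates, and every tuple [Y] in the ideal occurs.

    The group acts on near points by [(g xi)(f) = xi(f o g)]. In the charts of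
    the Weil bundle the coordinates of [g xi] are thus finite sums of Hasse
    derivatives of the action in the direction of [M], evaluated at [g] and at
    the base point, times polynomials in the coordinates of [xi]; these are
    analytic. The power series calculus this requires rests on unordered sums
    of families tending to 0 in a complete ultrametric field, for which
    Fubini's theorem holds without further hypotheses. *)

Set Implicit Arguments.
Unset Strict Implicit.
Unset Printing Implicit Defensive.

Import Order.TTheory GRing.Theory Num.Theory.
Local Open Scope ring_scope.

(** * Unordered sums in an ultrametric field *)

(** A near point is an algebra map on O(U) for one fixed [U]. Nothing in its definition says that
    its value on [f] depends only on [f] near the base point, and the coordinates of a chart need
    not be defined on [U]. Extension by zero from a clopen ball removes both obstacles: it makes
    elements of O(U) out of functions known only in a chart, and multiplication by the indicator
    localises. Near points are identified by the equivalence that passage to a larger neighbourhood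
    generates, so an invariant must be carried along zigzags; existence and uniqueness of [Y] do
    this. The lift on near points is formal. The analytic content is the joint dependence on the
    group element and the near point: the Taylor coefficients of the action with the group element
    frozen are also Taylor coefficients of the action in all variables, hence analytic in both.
    Truncation is by cubes of multi-indices rather than by total degree, since a monomial outside a
    cube contains a high power of a single variable. Hasse derivatives avoid division by factorials,
    which are p-adically small. *)

Lemma rat_le_eps (x y : rat) : (forall e, 0 < e -> x <= Num.max y e) -> 0 <= y -> x <= y.
Proof.
move=> h y0; rewrite leNgt; apply/negP => yx.
have xy0 : 0 < (x + y) / 2 by lra.
by have := h _ xy0; rewrite le_max => /orP[]; lra.
Qed.

(** Bernoulli's inequality for [x^-1] makes [x ^- k] grow at least linearly, and the rationals are
    archimedean. *)
Lemma rat_expr_small (x e : rat) : 0 <= x -> x < 1 -> 0 < e ->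
  exists N, forall k, (N <= k)%N -> x ^+ k <= e.
Proof.
move=> x0 x1 e0; case: (eqVneq x 0) => [->|xn0].
  by exists 1%N => -[//|k] _; rewrite expr0n ltW.
have xp : 0 < x by rewrite lt_neqAle eq_sym xn0.
have bern : forall k, 1 + k%:R * (x^-1 - 1) <= x ^- k.
  elim=> [|k ih]; first by rewrite mul0r addr0 expr0 invr1.
  have y1 : 1 <= x^-1 by rewrite invf_ge1 // ltW.
  rewrite exprSr invfM; apply: le_trans (ler_wpM2r _ ih); last by lra.
  rewrite -natr1; set y := x^-1 in y1 *.
  have : 0 <= (k%:R : rat) by [].
  set n : rat := k%:R => n0.
  have h : 0 <= n * (y - 1) ^+ 2 by rewrite mulr_ge0 // sqr_ge0.
  rewrite -subr_ge0; suff -> : (1 + n * (y - 1)) * y - (1 + (n + 1) * (y - 1)) = n * (y - 1) ^+ 2 by [].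
  by rewrite expr2; ring.
have d0 : 0 < x^-1 - 1 by rewrite subr_gt0 invf_gt1.
exists (Num.bound (e^-1 / (x^-1 - 1))) => k Nk.
rewrite -[x ^+ k]invrK invf_ple ?posrE ?invr_gt0 ?exprn_gt0 //.
apply: le_trans (bern k).
have q0 : 0 <= e^-1 / (x^-1 - 1) by rewrite divr_ge0 ?invr_ge0 // ltW.
have : e^-1 / (x^-1 - 1) <= k%:R.
  by apply: le_trans (ltW (archi_boundP q0)) _; rewrite ler_nat.
by rewrite ler_pdivrMr // => /le_trans; apply; rewrite lerDr.
Qed.

Section Absolute.
Variables (p : nat) (K : padicField p).
Local Notation nu := (@Qp_abs p K).

Let ax := Qp_axiom K.

Lemma abs_ge0 x : 0 <= nu x. Proof. exact: nu_ge0 ax x. Qed.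
Lemma abs0 : nu 0 = 0. Proof. exact/(nu_eq0 ax). Qed.
Lemma abs_eq0 x : (nu x == 0) = (x == 0).
Proof. by apply/eqP/eqP => /(nu_eq0 ax). Qed.
Lemma abs_gt0 x : (0 < nu x) = (x != 0).
Proof. by rewrite lt_neqAle abs_ge0 andbT eq_sym abs_eq0. Qed.
Lemma absM x y : nu (x * y) = nu x * nu y. Proof. exact: nuM ax x y. Qed.
Lemma abs1 : nu 1 = 1.
Proof.
have n0 : nu 1 != 0 by rewrite abs_eq0 oner_neq0.
by apply: (mulfI n0); rewrite -absM !mulr1.
Qed.
Lemma absN x : nu (- x) = nu x.
Proof.
rewrite -mulN1r absM; suff -> : nu (-1) = 1 by rewrite mul1r.
have /eqP : nu (-1) ^+ 2 = 1 by rewrite expr2 -absM mulrNN mulr1 abs1.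
by rewrite sqrf_eq1 => /orP[/eqP//|/eqP h]; have := abs_ge0 (-1); rewrite h; lra.
Qed.
Lemma absD_le x y e : nu x <= e -> nu y <= e -> nu (x + y) <= e.
Proof.
by move=> hx hy; apply: le_trans (nuD_max ax x y) _; rewrite ge_max hx.
Qed.
Lemma absB_le x y e : nu x <= e -> nu y <= e -> nu (x - y) <= e.
Proof. by move=> hx hy; apply: absD_le; rewrite ?absN. Qed.
Lemma absBC x y : nu (x - y) = nu (y - x).
Proof. by rewrite -absN opprB. Qed.
Lemma absX x n : nu (x ^+ n) = nu x ^+ n.
Proof. by elim: n => [|n ih]; rewrite ?expr0 ?abs1 // !exprS absM ih. Qed.
Lemma absV x : nu x^-1 = (nu x)^-1.
Proof.
case: (eqVneq x 0) => [->|x0]; first by rewrite invr0 abs0 invr0.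
apply: (mulfI (_ : nu x != 0)); rewrite ?abs_eq0 //.
by rewrite -absM !divff ?abs1 ?abs_eq0.
Qed.
Lemma abs_nat_le1 n : nu n%:R <= 1.
Proof.
elim: n => [|n ih]; first by rewrite abs0.
by rewrite -natr1 absD_le // abs1.
Qed.
Lemma abs_sum_le (I : eqType) (s : seq I) (P : pred I) (u : I -> K) (e : rat) : 0 <= e ->
  (forall i, i \in s -> P i -> nu (u i) <= e) -> nu (\sum_(i <- s | P i) u i) <= e.
Proof.
move=> e0 h; rewrite big_seq_cond; elim/big_rec: _ => [|i x /andP[si Pi] ih].
  by rewrite abs0.
by rewrite absD_le // h.
Qed.
Lemma abs_prod (I : Type) (s : seq I) (P : pred I) (u : I -> K) :
  nu (\prod_(i <- s | P i) u i) = \prod_(i <- s | P i) nu (u i).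
Proof. by elim/big_rec2: _ => [|i x y Pi <-]; rewrite ?abs1 ?absM. Qed.
Lemma abs_eq0_eps x : (forall e : rat, 0 < e -> nu x <= e) -> x = 0.
Proof.
move=> h; apply/eqP; rewrite -abs_eq0 eq_le abs_ge0 andbT.
by apply: rat_le_eps => // e e0; rewrite le_max; apply/orP; right; apply: h.
Qed.

Definition null_family (I : eqType) (w : I -> rat) :=
  forall e : rat, 0 < e -> exists s : seq I, forall i, i \notin s -> w i <= e.

(* The unordered sum of a family tending to 0 along the cofinite filter; by
   the ultrametric inequality one finite set with small tail suffices. *)
Definition hsum (I : eqType) (u : I -> K) (S : K) :=
  forall e : rat, 0 < e -> exists s : seq I,
    [/\ uniq s, forall i, i \notin s -> nu (u i) <= e & nu (\sum_(i <- s) u i - S) <= e].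

Section Sums.
Variable I : eqType.
Implicit Types (u v : I -> K).

(** Common terms cancel; the ultrametric inequality bounds what is left by its largest term, with no
    loss from the number of terms. *)
Lemma abs_sum_diff u (s t : seq I) (e : rat) : 0 <= e -> uniq s -> uniq t ->
  (forall i, i \in s -> i \notin t -> nu (u i) <= e) ->
  (forall i, i \in t -> i \notin s -> nu (u i) <= e) ->
  nu (\sum_(i <- s) u i - \sum_(i <- t) u i) <= e.
Proof.
move=> e0 us ut hs ht.
rewrite (bigID [in t]) /= [X in _ - X](bigID [in s]) /=.
have -> : \sum_(i <- s | i \in t) u i = \sum_(i <- t | i \in s) u i.
  rewrite -big_filter -[RHS]big_filter; apply: perm_big.
  by apply: uniq_perm; rewrite ?filter_uniq // => i; rewrite !mem_filter andbC.
rewrite opprD addrACA subrr add0r.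
by apply: absB_le; apply: abs_sum_le.
Qed.

Lemma hsum_null u S : hsum u S -> null_family (fun i => nu (u i)).
Proof. by move=> h e /h[s [_ hs _]]; exists s. Qed.

(** Every finite set with small tail approximates the sum, not only the one supplied by [hsum]:
    compare it with a set of arbitrary precision [d]. *)
Lemma hsum_tail u S (t : seq I) (e : rat) : 0 <= e -> hsum u S -> uniq t ->
  (forall i, i \notin t -> nu (u i) <= e) -> nu (\sum_(i <- t) u i - S) <= e.
Proof.
move=> e0 hS ut ht; apply: rat_le_eps => // d d0.
have [s [us hs hsS]] := hS _ d0.
rewrite -(subrKA (\sum_(i <- s) u i)); apply: absD_le; last by rewrite le_max hsS orbT.
apply: abs_sum_diff => // [|i _|i _]; first by rewrite le_max e0.
  by move/hs=> h; rewrite le_max h orbT.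
by move/ht=> h; rewrite le_max h.
Qed.

Lemma hsum_abs_le u S (e : rat) : 0 <= e -> hsum u S -> (forall i, nu (u i) <= e) -> nu S <= e.
Proof.
move=> e0 hS h; have := hsum_tail e0 hS (t := [::]) isT (fun i _ => h i).
by rewrite big_nil add0r absN.
Qed.

Lemma hsum_unique u S S' : hsum u S -> hsum u S' -> S = S'.
Proof.
move=> h h'; apply/eqP; rewrite -subr_eq0; apply/eqP; apply: abs_eq0_eps => e e0.
have [s [us hs hsS]] := h _ e0.
have h2 := hsum_tail (ltW e0) h' us hs.
by rewrite -(subrKA (\sum_(i <- s) u i)); apply: absD_le; rewrite // absBC.
Qed.

Lemma hsum_fin u (t : seq I) : uniq t -> (forall i, i \notin t -> u i = 0) ->
  hsum u (\sum_(i <- t) u i).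
Proof.
move=> ut ht e e0; exists t; split=> // [i /ht->|]; first by rewrite abs0 ltW.
by rewrite subrr abs0 ltW.
Qed.

Lemma hsum0 : hsum (fun _ : I => 0) 0.
Proof. by have := @hsum_fin (fun=> 0) [::] isT (fun _ _ => erefl); rewrite big_nil. Qed.

(** Completeness is available for sequences only, so the net of finite sets is replaced by sets
    [s k] with tail at most [1 / (k + 1)]; their partial sums form a Cauchy sequence. *)
Lemma hsum_exists u : null_family (fun i => nu (u i)) -> exists S, hsum u S.
Proof.
move=> nul; have e0 k : 0 < (k.+1%:R : rat)^-1 by rewrite invr_gt0 ltr0n.
pose s k := undup (projT1 (cid (nul _ (e0 k)))).
have hs k i : i \notin s k -> nu (u i) <= k.+1%:R^-1.
  by rewrite mem_undup; case: (cid _) => /= t h /h.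
have arch (e : rat) : 0 < e -> exists N, forall k, (N <= k)%N -> k.+1%:R^-1 <= e.
  move=> ep; exists (Num.bound e^-1) => k Nk; rewrite invf_ple ?posrE ?ltr0n //.
  have ei0 : 0 <= e^-1 by rewrite invr_ge0 ltW.
  by apply: le_trans (ltW (archi_boundP ei0)) _; rewrite ler_nat ltnW.
pose w k := \sum_(i <- s k) u i.
have dw k j (e : rat) : 0 < e -> k.+1%:R^-1 <= e -> j.+1%:R^-1 <= e -> nu (w k - w j) <= e.
  move=> ep ke je; apply: abs_sum_diff; rewrite ?undup_uniq ?ltW // => i _ /hs /le_trans; exact.
have [S hS] : exists l, forall e : rat, 0 < e ->
       exists N, forall i, (N <= i)%N -> nu (w i - l) < e.
  apply: (nu_complete ax) => e ep; have e2 : 0 < e / 2 by lra.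
  have [N hN] := arch _ e2; exists N => i j /hN hi /hN hj.
  by apply: le_lt_trans (dw _ _ _ e2 hi hj) _; lra.
exists S => e ep; have [N hN] := arch _ ep; have [N' hN'] := hS _ ep.
pose m := maxn N N'; exists (s m); split; first exact: undup_uniq.
  by move=> i /hs /le_trans; apply; apply: hN; rewrite leq_maxl.
by apply: ltW; apply: hN'; rewrite leq_maxr.
Qed.

Lemma hsumD u v S T : hsum u S -> hsum v T -> hsum (fun i => u i + v i) (S + T).
Proof.
move=> hu hv e e0; have [s [us hs _]] := hu _ e0; have [t [ut ht _]] := hv _ e0.
pose r := undup (s ++ t).
have hr i : i \notin r -> nu (u i) <= e /\ nu (v i) <= e.
  by rewrite mem_undup mem_cat negb_or => /andP[/hs ? /ht].
exists r; split; first exact: undup_uniq.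
  by move=> i /hr[? ?]; apply: absD_le.
rewrite big_split /= opprD addrACA; apply: absD_le; apply: hsum_tail; rewrite ?ltW ?undup_uniq //.
  by move=> i /hr[].
by move=> i /hr[].
Qed.

Lemma hsumZ u S k : hsum u S -> hsum (fun i => k * u i) (k * S).
Proof.
move=> hu e e0; case: (eqVneq k 0) => [->|k0].
  exists [::]; split=> // [i _|]; first by rewrite mul0r abs0 ltW.
  by rewrite big_nil mul0r subrr abs0 ltW.
have nk : 0 < nu k by rewrite abs_gt0.
have [s [us hs hS]] := hu _ (divr_gt0 e0 nk).
exists s; split=> // [i /hs h|]; rewrite -?mulr_sumr -?mulrBr absM mulrC -ler_pdivlMr //.
Qed.

Lemma eq_hsum u v S : u =1 v -> hsum u S -> hsum v S.
Proof. by move=> /funext ->. Qed.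

End Sums.

Lemma hsum_reindex (I J : eqType) (h : J -> I) (g : I -> J) (u : I -> K) S :
  cancel h g -> cancel g h -> hsum u S -> hsum (fun j => u (h j)) S.
Proof.
move=> hg gh hu e e0; have [s [us hs hS]] := hu _ e0.
exists (map g s); split; first by rewrite map_inj_uniq //; exact: can_inj gh.
  by move=> j js; apply: hs; apply: contra js => hj; apply/mapP; exists (h j).
by rewrite big_map; under eq_bigr do rewrite gh.
Qed.

(** A finite set of pairs with small tail lies in the rectangle of its two projections. Over that
    rectangle the double sum is within [e] of [S], and each row sum is within [e] of [b i]. *)
Lemma fubini_l (I J : eqType) (u : I * J -> K) (b : I -> K) S :
  (forall i, hsum (fun j => u (i, j)) (b i)) -> hsum u S -> hsum b S.
Proof.
move=> hb hu e e0; have [s [us hs hS]] := hu _ e0.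
exists (undup (map fst s)); split; first exact: undup_uniq.
  move=> i; rewrite mem_undup => hi; apply: hsum_abs_le (ltW e0) (hb i) _ => j.
  by apply: hs; apply: contra hi => hij; apply/mapP; exists (i, j).
set t := undup _; pose r := undup (map snd s).
have h1 : nu (\sum_(i <- t) b i - \sum_(i <- t) \sum_(j <- r) u (i, j)) <= e.
  rewrite -sumrB; apply: abs_sum_le (ltW e0) _ => i _ _; rewrite absBC.
  apply: hsum_tail (ltW e0) (hb i) (undup_uniq _) _ => j.
  rewrite mem_undup => hj; apply: hs; apply: contra hj => hij.
  by apply/mapP; exists (i, j).
rewrite -(subrKA (\sum_(i <- t) \sum_(j <- r) u (i, j))); apply: absD_le => //.
have -> : \sum_(i <- t) \sum_(j <- r) u (i, j) = \sum_(x <- [seq (i, j) | i <- t, j <- r]) u x.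
  by rewrite big_allpairs.
apply: hsum_tail (ltW e0) hu _ _.
  by rewrite allpairs_uniq ?undup_uniq // => -[? ?] [? ?] _ _ /= [-> ->].
move=> [i j] hij; apply: hs; apply: contra hij => sij.
apply/allpairsP; exists (i, j); rewrite !mem_undup; split=> //; apply/mapP; by exists (i, j).
Qed.

(** Nullity of the double family gives it some sum, which the previous lemma identifies. Nullity
    must be assumed: it does not follow from convergence of the iterated sums. *)
Lemma fubini_pair (I J : eqType) (u : I * J -> K) (b : I -> K) S :
  null_family (fun x => nu (u x)) ->
  (forall i, hsum (fun j => u (i, j)) (b i)) -> hsum b S -> hsum u S.
Proof.
move=> nul hb hS; have [S' hS'] := hsum_exists nul.
by rewrite (hsum_unique hS (fubini_l hb hS')).
Qed.

Lemma hsum1 (I : eqType) (i0 : I) (u : I -> K) : (forall i, i != i0 -> u i = 0) -> hsum u (u i0).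
Proof.
move=> h; have := @hsum_fin I u [:: i0] isT; rewrite big_seq1; apply=> i.
by rewrite inE => /h.
Qed.

(** Grouping terms along [phi] is Fubini for the family [v] on [I * J] supported on the graph of
    [phi]. *)
Lemma hsum_fibre (I J : eqType) (phi : J -> I) (u : J -> K) (b : I -> K) S :
  (forall i, hsum (fun j => if phi j == i then u j else 0) (b i)) -> hsum u S -> hsum b S.
Proof.
move=> hb hu; pose v (x : I * J) := if phi x.2 == x.1 then u x.2 else 0.
apply: (@fubini_l _ _ v) => //.
have hv j : hsum (fun i => v (i, j)) (u j).
  have := @hsum1 I (phi j) (fun i => v (i, j)); rewrite /v /= eqxx; apply=> i.
  by rewrite eq_sym => /negPf ->.
apply: (hsum_reindex (h := fun x : I * J => (x.2, x.1)) (g := fun x => (x.2, x.1))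
  (u := fun x : J * I => v (x.2, x.1)));
  rewrite ?/cancel; try by case.
apply: (fubini_pair (b := u)) => // e e0.
have [s [us hs _]] := hu _ e0; exists [seq (j, phi j) | j <- s] => -[j i] /= hij.
rewrite /v /=; case: eqP => [pij|_]; last by rewrite abs0 ltW.
apply: hs; apply: contra hij => js; apply/mapP; exists j => //; by rewrite pij.
Qed.

End Absolute.

(** * Multi-indices and power series *)

Section NullFamilies.
Variables (p : nat) (K : padicField p).
Local Notation nu := (@Qp_abs p K).

Lemma null_le (I : eqType) (v w : I -> rat) : (forall i, w i <= v i) ->
  null_family v -> null_family w.
Proof. by move=> h nv e /nv[s hs]; exists s => i /hs; apply: le_trans. Qed.

Lemma null_scale (I : eqType) (k : rat) (w : I -> rat) : 0 <= k -> null_family w ->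
  null_family (fun i => k * w i).
Proof.
move=> k0 nw e e0; have k1 : 0 < k + 1 by lra.
have [s hs] := nw _ (divr_gt0 e0 k1); exists s => i /hs.
rewrite ler_pdivlMr // => h.
have [w0|w0] := leP 0 (w i); first by rewrite mulrC; apply: le_trans h; rewrite ler_wpM2l //; lra.
by apply: le_trans (ltW e0); rewrite mulr_ge0_le0 // ltW.
Qed.

Lemma null_bounded (I : eqType) (w : I -> rat) : null_family w ->
  exists2 B, 0 < B & forall i, w i <= B.
Proof.
move=> /(_ 1 ltr01)[s hs].
have [B B0 hB] : exists2 B, 0 < B & forall i, i \in s -> w i <= B.
  elim: s {hs} => [|i s [B B0 hB]]; first by exists 1.
  exists (Num.max (w i) B); first by rewrite lt_max B0 orbT.
  by move=> j; rewrite inE le_max => /orP[/eqP->|/hB->]; rewrite ?lexx ?orbT.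
exists (Num.max 1 B); first by rewrite lt_max ltr01.
by move=> i; rewrite le_max; case: (boolP (i \in s)) => [/hB->|/hs->]; rewrite ?orbT.
Qed.

Lemma null_inj (I J : eqType) (h : J -> I) (g : I -> J) (w : I -> rat) : cancel h g ->
  null_family w -> null_family (fun j => w (h j)).
Proof.
move=> hg nw e /nw[s hs]; exists (map g s) => j js; apply: hs.
by apply: contra js => hj; apply/mapP; exists (h j).
Qed.

(** The bound by [v], uniform in the second index, leaves finitely many rows with large terms, and
    each of these rows is null. *)
Lemma null_pair (I J : eqType) (v : I -> rat) (w : I * J -> rat) :
  null_family v -> (forall i, null_family (fun j => w (i, j))) ->
  (forall x, w x <= v x.1) -> null_family w.
Proof.
move=> nv nw wv e e0; have [s hs] := nv _ e0.
have /choice[t ht] : forall i, exists t : seq J, forall j, j \notin t -> w (i, j) <= e.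
  by move=> i; apply: nw.
exists [seq (i, j) | i <- s, j <- t i] => -[i j] hij.
case: (boolP (i \in s)) => [si|/hs]; last by apply: le_trans; exact: wv.
apply: ht; apply: contra hij => tj; apply/allpairsPdep.
by exists i, j.
Qed.

Lemma null_mul (I J : eqType) (v : I -> rat) (w : J -> rat) :
  (forall i, 0 <= v i) -> (forall j, 0 <= w j) ->
  null_family v -> null_family w -> null_family (fun x : I * J => v x.1 * w x.2).
Proof.
move=> v0 w0 nv nw; have [B B0 hB] := null_bounded nw.
apply: (null_pair (v := fun i => B * v i)).
- by apply: null_scale => //; exact: ltW.
- by move=> i; exact: (null_scale (v0 i) nw).
- by move=> [i j] /=; rewrite mulrC ler_wpM2r.
Qed.

Lemma null_finite (I : eqType) (s : seq I) (w : I -> rat) :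
  (forall i, i \notin s -> w i = 0) -> null_family w.
Proof. by move=> h e e0; exists s => i /h->; exact: ltW. Qed.

Lemma null_add (I : eqType) (v w : I -> rat) : null_family v -> null_family w ->
  null_family (fun i => v i + w i).
Proof.
move=> nv nw e e0; have e2 : 0 < e / 2 by lra.
have [s hs] := nv _ e2; have [t ht] := nw _ e2; exists (s ++ t) => i.
by rewrite mem_cat negb_or => /andP[/hs h /ht h']; lra.
Qed.

Lemma hsumM (I J : eqType) (u : I -> K) (v : J -> K) S T : hsum u S -> hsum v T ->
  hsum (fun x : I * J => u x.1 * v x.2) (S * T).
Proof.
move=> hu hv; apply: (fubini_pair (b := fun i => u i * T)) => /=.
- have := null_mul _ _ (hsum_null hu) (hsum_null hv).
  by move/(_ (fun=> abs_ge0 _) (fun=> abs_ge0 _)); under eq_fun do rewrite -absM.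
- by move=> i; apply: hsumZ.
- by rewrite mulrC; under eq_fun do rewrite mulrC; apply: hsumZ.
Qed.

Lemma hsum_inj (I J : eqType) (h : J -> I) (g : I -> J) (u : I -> K) S : cancel h g ->
  (forall i, h (g i) != i -> u i = 0) -> hsum u S -> hsum (fun j => u (h j)) S.
Proof.
move=> hg u0 hu e e0; have [s [us hs hS]] := hu _ e0.
pose s' := [seq i <- s | h (g i) == i].
exists (map g s'); split.
- rewrite map_inj_in_uniq ?filter_uniq // => i j.
  by rewrite !mem_filter => /andP[/eqP<- _] /andP[/eqP<- _]; rewrite !hg => ->.
- move=> j js; apply: hs; apply: contra js => hj; apply/mapP; exists (h j) => //.
  by rewrite mem_filter hg eqxx.
- rewrite big_map big_filter; suff <- : \sum_(i <- s) u i = \sum_(i <- s | h (g i) == i) u (h (g i)) by [].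
  rewrite (bigID (fun i => h (g i) == i)) /= [X in _ + X]big1 ?addr0; last by move=> i /u0.
  by apply: eq_bigr => i /eqP ->.
Qed.

Lemma hsum_sum (I : eqType) (T : Type) (s : seq T) (u : T -> I -> K) (S : T -> K) :
  (forall k, hsum (u k) (S k)) -> hsum (fun i => \sum_(k <- s) u k i) (\sum_(k <- s) S k).
Proof.
move=> h; elim: s => [|k s ih].
  by rewrite big_nil; under eq_fun do rewrite big_nil; exact: hsum0.
by rewrite big_cons; under eq_fun do rewrite big_cons; apply: hsumD.
Qed.

End NullFamilies.

Section MultiIndex.
Variable n : nat.

(** Finite functions, and not the plain functions ['I_n -> nat] of [ps_converges], because [hsum]
    needs an index type with decidable equality. *)
Definition mi := {ffun 'I_n -> nat}.
Implicit Types a b : mi.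

Definition madd a b : mi := [ffun i => (a i + b i)%N].
Definition msub a b : mi := [ffun i => (a i - b i)%N].
Definition m0 : mi := [ffun=> 0%N].
Definition munit (k : 'I_n) (N : nat) : mi := [ffun i => if i == k then N else 0%N].
Definition mbin a b : nat := (\prod_i 'C(a i, b i))%N.
Definition mle a b := [forall i, (a i <= b i)%N].
(** Indexing the cube by [{ffun 'I_n -> 'I_N}] matches [ps_partial], so that its partial sums become
    sums over [box]. *)
Definition mbox (N : nat) (f : {ffun 'I_n -> 'I_N}) : mi := [ffun i => f i : nat].

Lemma mbox_inj N : injective (@mbox N).
Proof.
by move=> f g /ffunP h; apply/ffunP => i; apply: val_inj; have := h i; rewrite !ffunE.
Qed.

Lemma mboxP N a : (forall i, (a i < N)%N) -> exists f : {ffun 'I_n -> 'I_N}, a = mbox f.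
Proof.
move=> h; exists [ffun i => Ordinal (h i)]; apply/ffunP => i; by rewrite !ffunE.
Qed.

Definition box N : seq mi := [seq mbox f | f <- enum {: {ffun 'I_n -> 'I_N}}].

Lemma box_uniq N : uniq (box N).
Proof. by rewrite map_inj_uniq ?enum_uniq //; exact: mbox_inj. Qed.

Lemma mem_box N a : (forall i, (a i < N)%N) -> a \in box N.
Proof. by move=> /mboxP[f ->]; apply: map_f; rewrite mem_enum. Qed.

Lemma big_box (R : nmodType) N (u : mi -> R) :
  \sum_(a <- box N) u a = \sum_(f : {ffun 'I_n -> 'I_N}) u (mbox f).
Proof. by rewrite big_map big_enum. Qed.

Lemma mdegD a b : mdeg (madd a b) = (mdeg a + mdeg b)%N.
Proof. by rewrite /mdeg -big_split; apply: eq_bigr => i _; rewrite ffunE. Qed.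

Lemma msubK a b : mle b a -> madd (msub a b) b = a.
Proof. by move=> /forallP h; apply/ffunP => i; rewrite !ffunE subnK. Qed.

Lemma mbin0 a b : ~~ mle b a -> mbin a b = 0%N.
Proof.
rewrite negb_forall => /existsP[i]; rewrite -ltnNge => h.
by rewrite /mbin (bigD1 i) //= bin_small.
Qed.

Lemma mle_deg a i : (a i <= mdeg a)%N.
Proof. by rewrite /mdeg (bigD1 i) //= leq_addr. Qed.

Lemma mdeg_max (s : seq mi) a : a \in s -> (mdeg a <= \max_(b <- s) mdeg b)%N.
Proof.
elim: s => // b s ih; rewrite inE big_cons leq_max => /orP[/eqP->|/ih->]; rewrite ?leqnn ?orbT //.
Qed.

Lemma mdeg_eq0 a : (mdeg a == 0%N) = (a == m0).
Proof.
apply/eqP/eqP => [h|->].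
  by apply/ffunP => i; rewrite ffunE; have := mle_deg a i; rewrite h leqn0 => /eqP.
by rewrite /mdeg big1 // => i _; rewrite ffunE.
Qed.

Lemma mdeg_unit k N : mdeg (munit k N) = N.
Proof.
rewrite /mdeg (bigD1 k) //= ffunE eqxx big1 ?addn0 // => i /negPf ik.
by rewrite ffunE ik.
Qed.

Lemma mle_munit k N a : mle (munit k N) a = (N <= a k)%N.
Proof.
apply/forallP/idP => [/(_ k)|h i]; rewrite ffunE ?eqxx //.
by case: eqP => [->|].
Qed.

End MultiIndex.

(** * Convergent power series on closed balls and their Gauss norms *)

Section PowerSeries.
Variables (p : nat) (K : padicField p).
Local Notation nu := (@Qp_abs p K).

Section Dim.
Variable n : nat.
Local Notation mi := (mi n).
Implicit Types (x y z : 'rV[K]_n) (a b : mi) (c : mi -> K) (r s e : rat) (F G : 'rV[K]_n -> K).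

Lemma monomD z a b : monom z (madd a b) = monom z a * monom z b.
Proof. by rewrite /monom -big_split; apply: eq_bigr => i _; rewrite ffunE exprD. Qed.

Lemma monom_m0 z : monom z (m0 n) = 1.
Proof. by rewrite /monom big1 // => i _; rewrite ffunE expr0. Qed.

Lemma monom_unit z k N : monom z (munit k N) = z 0 k ^+ N.
Proof.
rewrite /monom (bigD1 k) //= ffunE eqxx big1 ?mulr1 // => i /negPf ik.
by rewrite ffunE ik expr0.
Qed.

Lemma monom0 a : monom (0 : 'rV[K]_n) a = (a == m0 n)%:R.
Proof.
case: eqVneq => [->|a0]; first by rewrite monom_m0.
have /existsP[i ai] : [exists i, a i != 0%N].
  rewrite -negb_forall; apply: contra a0 => /forallP h.
  by apply/eqP/ffunP => i; rewrite ffunE; apply/eqP.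
by rewrite /monom (bigD1 i) //= mxE expr0n (negPf ai) mul0r.
Qed.

Lemma abs_monom_le z a r : 0 <= r -> (forall i, nu (z 0 i) <= r) -> nu (monom z a) <= r ^+ mdeg a.
Proof.
move=> r0 h; rewrite /monom /mdeg abs_prod -prodrXr; apply: ler_prod => i _.
by rewrite abs_ge0 absX lerXn2r ?nnegrE ?abs_ge0.
Qed.

Lemma cballE x r y : cball x r y <-> (forall i, nu ((y - x) 0 i) <= r).
Proof. by split=> h i; have := h i; rewrite !mxE. Qed.

Lemma cball_center x r : 0 <= r -> cball x r x.
Proof. by move=> r0 i; rewrite subrr abs0. Qed.

Lemma cball_sym x r y : cball x r y -> cball y r x.
Proof. by move=> h i; rewrite absBC. Qed.

Lemma cball_trans x r y z : cball x r y -> cball y r z -> cball x r z.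
Proof. by move=> h h' i; rewrite -(subrKA (y 0 i)); apply: absD_le. Qed.

Lemma cball_le x r s y : r <= s -> cball x r y -> cball x s y.
Proof. by move=> rs h i; apply: le_trans rs. Qed.

Definition expands x r c F :=
  null_family (fun a => nu (c a) * r ^+ mdeg a) /\
  forall y, cball x r y -> hsum (fun a => c a * monom (y - x) a) (F y).

(* The Gauss norm of F on the ball is at most rho. *)
Definition tate_le x r (rho : rat) F :=
  exists2 c, expands x r c F & forall a, nu (c a) * r ^+ mdeg a <= rho.

Lemma abs_term_le x r y k a : 0 <= r -> cball x r y ->
  nu (k * monom (y - x) a) <= nu k * r ^+ mdeg a.
Proof.
move=> r0 /cballE h; rewrite absM; apply: ler_wpM2l; first exact: abs_ge0.
exact: abs_monom_le.
Qed.

(** Coefficients attached to the same multi-index are added up, and ultrametric bounds pass to the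
    sums unchanged. Products, substitution, re-expansion at another point and division by a power of
    a variable are all instances, with different [I] and [phi]. *)
Lemma expands_regroup (I : eqType) (phi : I -> mi) (c : I -> K) x r F : 0 < r ->
  null_family (fun i => nu (c i) * r ^+ mdeg (phi i)) ->
  (forall y, cball x r y -> hsum (fun i => c i * monom (y - x) (phi i)) (F y)) ->
  exists C, [/\ expands x r C F,
    forall a, hsum (fun i => if phi i == a then c i else 0) (C a) &
    forall rho, 0 <= rho -> (forall i, nu (c i) * r ^+ mdeg (phi i) <= rho) ->
      forall a, nu (C a) * r ^+ mdeg a <= rho].
Proof.
move=> r0 nul hF.
have rp a : 0 < r ^+ mdeg a by rewrite exprn_gt0.
have /choice[C hC] : forall a, exists S, hsum (fun i => if phi i == a then c i else 0) S.
  move=> a; apply: hsum_exists => e e0; have [s hs] := nul _ (mulr_gt0 e0 (rp a)).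
  exists s => i /hs h; case: eqP => [pa|_]; last by rewrite abs0 ltW.
  by move: h; rewrite pa ler_pM2r.
have bnd rho a : 0 <= rho -> (forall i, phi i = a -> nu (c i) * r ^+ mdeg a <= rho) ->
    nu (C a) * r ^+ mdeg a <= rho.
  move=> rho0 h; rewrite -ler_pdivlMr //; apply: hsum_abs_le (hC a) _.
    by rewrite divr_ge0 // ltW.
  move=> i; case: eqP => [/h|_]; first by rewrite -ler_pdivlMr.
  by rewrite abs0 divr_ge0 // ltW.
exists C; split=> //; last by move=> rho rho0 h a; apply: bnd => // i <-.
split=> [e e0|y yx].
  have [s hs] := nul _ e0; exists (map phi s) => a ha; apply: bnd (ltW e0) _ => i pa.
  rewrite -pa; apply: hs; apply: contra ha => si; by apply/mapP; exists i.
apply: (hsum_fibre (phi := phi)) (hF y yx) => a.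
have := hsumZ (monom (y - x) a) (hC a); rewrite mulrC; apply: eq_hsum => i.
by case: eqP => [->|_]; rewrite ?mulr0 // mulrC.
Qed.

Lemma hsum_fun (I : eqType) (phi : I -> mi) (c : I -> K) x r : 0 <= r ->
  null_family (fun i => nu (c i) * r ^+ mdeg (phi i)) ->
  exists F, forall y, cball x r y -> hsum (fun i => c i * monom (y - x) (phi i)) (F y).
Proof.
move=> r0 nul.
have /choice[F hF] : forall y, exists S,
    cball x r y -> hsum (fun i => c i * monom (y - x) (phi i)) S.
  move=> y; case: (pselect (cball x r y)) => [h|]; last by exists 0.
  have [|S hS] := @hsum_exists p K I (fun i => c i * monom (y - x) (phi i)).
    by apply: null_le nul => i; apply: abs_term_le.
  by exists S.
by exists F.
Qed.

Lemma expandsW x r s c F : 0 < s -> s <= r -> expands x r c F -> expands x s c F.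
Proof.
move=> s0 sr [nul h]; split; last by move=> y /(cball_le sr) /h.
apply: null_le nul => a; apply: ler_wpM2l; first exact: abs_ge0.
have r0 := lt_le_trans s0 sr.
by apply: lerXn2r => //; rewrite nnegrE ltW.
Qed.

Lemma expands_ext x r c F G : (forall y, cball x r y -> F y = G y) ->
  expands x r c F -> expands x r c G.
Proof. by move=> FG [nul h]; split=> // y yx; rewrite -FG //; apply: h. Qed.

Lemma expands_monom x r k a0 :
  expands x r (fun a => if a == a0 then k else 0) (fun y => k * monom (y - x) a0).
Proof.
split; first by apply: (null_finite (s := [:: a0])) => a; rewrite inE => /negPf ->; rewrite abs0 mul0r.
move=> y _; have := @hsum1 p K _ a0 (fun a => (if a == a0 then k else 0) * monom (y - x) a).
by rewrite eqxx; apply=> a /negPf ->; rewrite mul0r.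
Qed.

Lemma expands_const x r k : expands x r (fun a => if a == m0 n then k else 0) (fun=> k).
Proof. by apply: expands_ext (expands_monom x r k (m0 n)) => y _; rewrite monom_m0 mulr1. Qed.

Lemma expandsD x r c d F G : 0 <= r -> expands x r c F -> expands x r d G ->
  expands x r (fun a => c a + d a) (fun y => F y + G y).
Proof.
move=> r0 [nc hc] [nd hd]; split.
  apply: null_le (null_add nc nd) => a; rewrite -mulrDl; apply: ler_wpM2r.
    by rewrite exprn_ge0.
  by apply: absD_le; rewrite ?lerDl ?lerDr abs_ge0.
move=> y yx; have := hsumD (hc y yx) (hd y yx); apply: eq_hsum => a; by rewrite mulrDl.
Qed.

Lemma expandsZ x r k c F : expands x r c F ->
  expands x r (fun a => k * c a) (fun y => k * F y).
Proof.
move=> [nc hc]; split.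
  by under eq_fun do rewrite absM -mulrA; apply: null_scale => //; exact: abs_ge0.
by move=> y yx; under eq_fun do rewrite -mulrA; apply: hsumZ; exact: hc.
Qed.

Lemma expandsM x r c d F G : 0 < r -> expands x r c F -> expands x r d G ->
  exists C, [/\ expands x r C (fun y => F y * G y),
    forall b, hsum (fun ab : mi * mi => if madd ab.1 ab.2 == b then c ab.1 * d ab.2 else 0) (C b) &
    forall rho sig, 0 <= rho -> 0 <= sig -> (forall a, nu (c a) * r ^+ mdeg a <= rho) ->
      (forall a, nu (d a) * r ^+ mdeg a <= sig) -> forall a, nu (C a) * r ^+ mdeg a <= rho * sig].
Proof.
move=> r0 [nc hc] [nd hd].
have w0 c' a : 0 <= nu (c' a) * r ^+ mdeg a.
  by rewrite mulr_ge0 ?abs_ge0 // exprn_ge0 // ltW.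
have eqw (ab : mi * mi) : nu (c ab.1 * d ab.2) * r ^+ mdeg (madd ab.1 ab.2) =
    (nu (c ab.1) * r ^+ mdeg ab.1) * (nu (d ab.2) * r ^+ mdeg ab.2).
  by rewrite absM mdegD exprD mulrACA.
have [||C [h1 h2 h3]] := @expands_regroup (mi * mi)%type (fun ab => madd ab.1 ab.2)
  (fun ab => c ab.1 * d ab.2) x r (fun y => F y * G y) r0.
- by apply: null_le (null_mul (w0 c) (w0 d) nc nd) => ab; rewrite eqw.
- move=> y yx; have := hsumM (hc y yx) (hd y yx); apply: eq_hsum => ab.
  by rewrite monomD mulrACA.
exists C; split=> // rho sig rho0 sig0 hr hs a; apply: h3 => [|ab]; first exact: mulr_ge0.
by rewrite eqw; apply: ler_pM.
Qed.

Lemma tate_const x r k : tate_le x r (nu k) (fun=> k).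
Proof.
exists (fun a => if a == m0 n then k else 0); first exact: expands_const.
move=> a; case: eqVneq => [/eqP|_]; last by rewrite abs0 mul0r abs_ge0.
by rewrite -mdeg_eq0 => /eqP ->; rewrite mulr1.
Qed.

Lemma tateM x r rho sig F G : 0 < r -> 0 <= rho -> 0 <= sig -> tate_le x r rho F -> tate_le x r sig G ->
  tate_le x r (rho * sig) (fun y => F y * G y).
Proof.
move=> r0 rho0 sig0 [c hc bc] [d hd bd].
by have [C [h1 _ h3]] := expandsM r0 hc hd; exists C => //; apply: h3.
Qed.

Lemma tateX x r rho F m : 0 < r -> 0 <= rho -> tate_le x r rho F ->
  tate_le x r (rho ^+ m) (fun y => F y ^+ m).
Proof.
move=> r0 rho0 hF; elim: m => [|m ih].
  by have := tate_const x r 1; rewrite abs1.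
rewrite exprS; under eq_fun do rewrite exprS; apply: tateM => //; exact: exprn_ge0.
Qed.

Lemma tate_prod x r (T : Type) (s : seq T) (rho : T -> rat) (F : T -> 'rV[K]_n -> K) : 0 < r ->
  (forall i, 0 <= rho i) -> (forall i, tate_le x r (rho i) (F i)) ->
  tate_le x r (\prod_(i <- s) rho i) (fun y => \prod_(i <- s) F i y).
Proof.
move=> r0 rho0 hF; elim: s => [|i s ih].
  rewrite big_nil; under eq_fun do rewrite big_nil.
  by have := tate_const x r 1; rewrite abs1.
have -> : (fun y => \prod_(j <- i :: s) F j y) = fun y => F i y * \prod_(j <- s) F j y.
  by apply/funext => y; rewrite big_cons.
by rewrite big_cons; apply: tateM => //; apply: prodr_ge0.
Qed.

(** Gauss norms tending to 0 make the coefficients of all the [f i] together a null family, so a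
    series of power series can be summed coefficient by coefficient. *)
Lemma tate_hsum (I : eqType) (rho : I -> rat) (f : I -> 'rV[K]_n -> K) x r F : 0 < r ->
  null_family rho -> (forall i, tate_le x r (rho i) (f i)) ->
  (forall y, cball x r y -> hsum (fun i => f i y) (F y)) -> exists c, expands x r c F.
Proof.
move=> r0 nrho hf hF.
have /choice[c hc] : forall i, exists c, expands x r c (f i) /\ (forall a, nu (c a) * r ^+ mdeg a <= rho i).
  by move=> i; have [c] := hf i; exists c.
have nul : null_family (fun ia : I * mi => nu (c ia.1 ia.2) * r ^+ mdeg ia.2).
  apply: (null_pair nrho) => [i|[i a]]; [exact: (hc i).1.1 | exact: (hc i).2].
have [||C [h1 _ _]] := @expands_regroup (I * mi)%type snd
  (fun ia => c ia.1 ia.2) x r F r0; [by []| |by exists C].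
move=> y yx; apply: (fubini_pair (b := fun i => f i y)) => [|i|]; last exact: hF.
  by apply: null_le nul => ia; apply: abs_term_le => //; exact: ltW.
exact: (hc i).1.2.
Qed.

Lemma expands_center x r c F : 0 <= r -> expands x r c F -> F x = c (m0 n).
Proof.
move=> r0 [_ /(_ x (cball_center x r0)) h]; apply: hsum_unique h _.
have := @hsum1 p K _ (m0 n) (fun a => c a * monom (x - x) a).
rewrite subrr monom0 eqxx mulr1; apply=> a /negPf a0.
by rewrite monom0 a0 mulr0.
Qed.

(* Removing the constant term, the remaining ones shrink at least linearly
   with the radius. *)
Lemma expands_small x r c F e : 0 < r -> 0 < e -> expands x r c F ->
  exists2 s, 0 < s & forall s', 0 < s' -> s' <= s -> tate_le x s' e (fun y => F y - F x).
Proof.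
move=> r0 e0 hF; have [B B0 hB] := null_bounded hF.1.
(* In degree at least 1, a term bounded by [B] at radius [r] is bounded by [B * t] at radius [r * t]
   because [t <= 1]; the second bound on [t] makes this at most [e]. *)
pose t := Num.min 1 (e / B); have t0 : 0 < t by rewrite lt_min ltr01 divr_gt0.
exists (r * t); first exact: mulr_gt0.
move=> s s0 srt; have sr : s <= r.
  by apply: le_trans srt _; rewrite -[leRHS]mulr1 ler_wpM2l ?ge_min ?lexx // ltW.
have hs := expandsW s0 sr hF.
have := expandsD (ltW s0) hs (expands_const x s (- F x)); set d := fun a => _ => hd.
exists d => // a; rewrite /d; case: eqVneq => [->|a0].
  by rewrite (expands_center (ltW r0) hF) subrr abs0 mul0r ltW.
have : (0 < mdeg a)%N by rewrite lt0n mdeg_eq0.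
rewrite addr0; case: (mdeg a) (hB a) => // m hBa _.
have sx : s ^+ m.+1 <= (r * t) ^+ m.+1 by apply: lerXn2r => //; rewrite nnegrE ltW // mulr_gt0.
apply: le_trans (ler_wpM2l (abs_ge0 _) sx) _.
rewrite exprMn mulrA; apply: le_trans (ler_wpM2r (exprn_ge0 _ (ltW t0)) hBa) _.
rewrite -ler_pdivlMl // mulrC exprS.
have tl : t <= e / B by rewrite ge_min lexx orbT.
apply: le_trans tl; rewrite -[leRHS]mulr1; apply: ler_wpM2l; first exact: ltW.
by apply: exprn_ile1; rewrite ?ge_min ?lexx // ltW.
Qed.

(** Only finitely many multi-indices have a given bounded degree, so decay in the degree is decay
    along the cofinite filter. The cubes of [ps_partial] exhaust all multi-indices, so its limit is
    the unordered sum. *)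
Lemma analyticP F x : analytic_at F x <-> exists r c, 0 < r /\ expands x r c F.
Proof.
split=> [[r [c [r0 cv hF]]]|[r [c [r0 [nul hF]]]]].
  pose c' (a : mi) := c a; exists r, c'; split=> //.
  have nul : null_family (fun a : mi => nu (c' a) * r ^+ mdeg a).
    move=> e /cv[N hN]; exists (box n N.+1) => a ha.
    apply: ltW; apply: hN; rewrite leqNgt; apply: contra ha => h.
    apply: mem_box.
    by move=> i; apply: leq_ltn_trans (mle_deg a i) _; rewrite ltnW.
  split=> // y yx.
  have [|S hS] := @hsum_exists p K _ (fun a : mi => c' a * monom (y - x) a).
    by apply: null_le nul => a; apply: abs_term_le => //; exact: ltW.
  suff -> : F y = S by [].
  apply/eqP; rewrite -subr_eq0; apply/eqP; apply: abs_eq0_eps => e e0.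
  have [N hN] := hF _ yx _ e0; have [s [us hs _]] := hS _ e0.
  pose m := maxn N (\max_(a <- s) mdeg a).+1.
  have h1 := hN m (leq_maxl _ _).
  rewrite -(subrKA (ps_partial c (y - x) m)); apply: absD_le.
    by rewrite absBC ltW.
  have -> : ps_partial c (y - x) m =
      \sum_(a <- box n m) c' a * monom (y - x) a.
    rewrite big_box /ps_partial; apply: eq_bigr => f _; rewrite /c'.
    have -> : (mbox f : 'I_n -> nat) = fun i => f i :> nat by apply/funext => i; rewrite ffunE.
    by [].
  apply: hsum_tail (ltW e0) hS _ _.
    exact: box_uniq.
  move=> a ha; apply: hs; apply: contra ha => sa.
  apply: mem_box.
  move=> i; apply: leq_ltn_trans (mle_deg a i) _; rewrite leq_max ltnS.
  by rewrite mdeg_max ?orbT.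
pose c' (a : 'I_n -> nat) := c (finfun a).
exists r, c'; split=> //.
  move=> e e0; have e2 : 0 < e / 2 by lra.
  have [s hs] := nul _ e2; exists (\max_(a <- s) mdeg a).+1 => a ha.
  have am : mdeg a = mdeg (finfun a : mi) by apply: eq_bigr => i _; rewrite ffunE.
  apply: le_lt_trans (_ : _ <= e / 2) _; last by lra.
  rewrite am; apply: hs; apply/negP => sa.
  by move: ha; rewrite am ltnNge mdeg_max.
move=> y yx e e0; have e2 : 0 < e / 2 by lra.
have hS := hF y yx; have [s [us hs _]] := hS _ e2.
exists (\max_(a <- s) mdeg a).+1 => m hm.
have -> : ps_partial c' (y - x) m =
    \sum_(a <- box n m) c a * monom (y - x) a.
  rewrite big_box /ps_partial; apply: eq_bigr => f _; rewrite /c'.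
  have e1 : (mbox f : 'I_n -> nat) = fun i => f i :> nat by apply/funext => i; rewrite ffunE.
  by rewrite -e1; congr (c _ * _); apply/ffunP => i; rewrite !ffunE.
apply: le_lt_trans (_ : _ <= e / 2) _; last by lra.
apply: hsum_tail (ltW e2) hS _ _.
  exact: box_uniq.
move=> a ha; apply: hs; apply: contra ha => sa.
apply: mem_box.
move=> i; apply: leq_ltn_trans (mle_deg a i) _; apply: leq_trans hm; rewrite ltnS.
exact: mdeg_max.
Qed.

End Dim.
End PowerSeries.

(** * Analytic functions and Taylor coefficients *)

Lemma min_pos (T : eqType) (t : seq T) (f : T -> rat) : (forall j, 0 < f j) ->
  exists2 s, 0 < s & forall j, j \in t -> s <= f j.
Proof.
move=> f0; elim: t => [|j t [s s0 hs]]; first by exists 1.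
exists (Num.min (f j) s); first by rewrite lt_min f0.
by move=> i; rewrite inE ge_min => /orP[/eqP->|/hs->]; rewrite ?lexx ?orbT.
Qed.

Section AnalyticFunctions.
Variables (p : nat) (K : padicField p).
Local Notation nu := (@Qp_abs p K).

Section Dim.
Variable n : nat.
Implicit Types (x y z : 'rV[K]_n) (r s e : rat) (F G : 'rV[K]_n -> K).

Lemma tate_abs x r rho F y : 0 <= r -> 0 <= rho -> tate_le x r rho F -> cball x r y ->
  nu (F y) <= rho.
Proof.
move=> r0 rho0 [c [_ hF] hc] yx; apply: hsum_abs_le rho0 (hF y yx) _ => a.
exact: le_trans (abs_term_le _ _ r0 yx) (hc a).
Qed.

Lemma analytic_local F G x r : 0 < r -> (forall y, cball x r y -> F y = G y) ->
  analytic_at F x -> analytic_at G x.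
Proof.
move=> r0 FG /analyticP[s [c [s0 hF]]]; apply/analyticP; exists (Num.min r s), c.
have m0 : 0 < Num.min r s by rewrite lt_min r0.
split=> //; apply: expands_ext (expandsW m0 _ hF); last by rewrite ge_min lexx orbT.
by move=> y /cball_le h; apply: FG; apply: h; rewrite ge_min lexx.
Qed.

Lemma analytic_common F G x : analytic_at F x -> analytic_at G x ->
  exists r c d, [/\ 0 < r, expands x r c F & expands x r d G].
Proof.
move=> /analyticP[r [c [r0 hF]]] /analyticP[s [d [s0 hG]]].
have m0 : 0 < Num.min r s by rewrite lt_min r0.
exists (Num.min r s), c, d; split=> //; [apply: expandsW hF | apply: expandsW hG] => //;
  by rewrite ge_min lexx ?orbT.
Qed.

Lemma analytic_const k x : analytic_at (fun=> k : K) x.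
Proof. by apply/analyticP; exists 1, (fun a => if a == m0 n then k else 0); split=> //; exact: expands_const. Qed.

Lemma analyticD F G x : analytic_at F x -> analytic_at G x -> analytic_at (fun y => F y + G y) x.
Proof.
move=> hF hG; have [r [c [d [r0 hc hd]]]] := analytic_common hF hG; apply/analyticP.
by exists r, (fun a => c a + d a); split=> //; apply: expandsD => //; exact: ltW.
Qed.

Lemma analyticM F G x : analytic_at F x -> analytic_at G x -> analytic_at (fun y => F y * G y) x.
Proof.
move=> hF hG; have [r [c [d [r0 hc hd]]]] := analytic_common hF hG; apply/analyticP.
by have [C [h _ _]] := expandsM r0 hc hd; exists r, C.
Qed.

Lemma analytic_sum (T : Type) (t : seq T) (P : pred T) (F : T -> 'rV[K]_n -> K) x :
  (forall i, analytic_at (F i) x) -> analytic_at (fun y => \sum_(i <- t | P i) F i y) x.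
Proof.
move=> hF; elim: t => [|i t ih].
  by under eq_fun do rewrite big_nil; exact: analytic_const.
have -> : (fun y => \sum_(j <- i :: t | P j) F j y) =
    fun y => (if P i then F i y else 0) + \sum_(j <- t | P j) F j y.
  by apply/funext => y; rewrite big_cons; case: ifP; rewrite ?add0r.
by apply: analyticD => //; case: (P i) => //; exact: analytic_const.
Qed.

Lemma expands_coord x r k :
  expands x r (fun a => (if a == m0 n then x 0 k else 0) + (if a == munit k 1 then 1 else 0))
    (fun y => y 0 k).
Proof.
case: (ltP r 0) => [rn|r0].
  split.
    apply: (null_finite (s := [:: m0 n; munit k 1])) => a.
    by rewrite !inE negb_or => /andP[/negPf-> /negPf->]; rewrite addr0 abs0 mul0r.
  by move=> y /(_ k) h; have := le_lt_trans h rn; rewrite ltNge abs_ge0.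
have := expandsD r0 (expands_const x r (x 0 k)) (expands_monom x r 1 (munit k 1)).
by apply: expands_ext => y _; rewrite monom_unit !mxE expr1 mul1r addrCA subrr addr0.
Qed.

Lemma analytic_coord k x : analytic_at (fun y => y 0 k) x.
Proof. by apply/analyticP; exists 1, (fun a => (if a == m0 n then x 0 k else 0) + (if a == munit k 1 then 1 else 0)); split=> //; exact: expands_coord. Qed.

Lemma analytic_small F x e : 0 < e -> analytic_at F x ->
  exists2 s, 0 < s & forall s', 0 < s' -> s' <= s -> tate_le x s' e (fun y => F y - F x).
Proof. by move=> e0 /analyticP[r [c [r0 hF]]]; apply: expands_small e0 hF. Qed.

Lemma analytic_maps_small m (G : 'rV[K]_n -> 'rV[K]_m) x e : 0 < e ->
  (forall j, analytic_at (fun y => G y 0 j) x) ->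
  exists2 s, 0 < s & forall s', 0 < s' -> s' <= s -> forall j, tate_le x s' e (fun y => G y 0 j - G x 0 j).
Proof.
move=> e0 hG.
have /choice[f hf] : forall j, exists s, 0 < s /\ forall s', 0 < s' -> s' <= s -> tate_le x s' e (fun y => G y 0 j - G x 0 j).
  by move=> j; have [s] := analytic_small e0 (hG j); exists s.
have [s s0 hs] := @min_pos _ (enum 'I_m) f (fun j => (hf j).1).
exists s => // s' s'0 s's j; apply: (hf j).2 => //; apply: le_trans s's _.
by apply: hs; rewrite mem_enum.
Qed.

Lemma analytic_continuous m (G : 'rV[K]_n -> 'rV[K]_m) x e : 0 < e ->
  (forall j, analytic_at (fun y => G y 0 j) x) ->
  exists2 s, 0 < s & forall y, cball x s y -> cball (G x) e (G y).
Proof.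
move=> e0 hG; have [s s0 hs] := analytic_maps_small e0 hG; exists s => // y yx j.
exact: tate_abs (ltW s0) (ltW e0) (hs s s0 (lexx s) j) yx.
Qed.

End Dim.

(** The radius [s] is taken so small that the components of [G - G x] have Gauss norm at most [r].
    The term of multi-index [a] after substitution then has Gauss norm at most
    [nu (c a) * r ^+ mdeg a], which tends to 0. *)
Lemma analytic_comp m n (F : 'rV[K]_m -> K) (G : 'rV[K]_n -> 'rV[K]_m) x :
  (forall j, analytic_at (fun y => G y 0 j) x) -> analytic_at F (G x) ->
  analytic_at (fun y => F (G y)) x.
Proof.
move=> hG /analyticP[r [c [r0 [nul hF]]]].
have [s s0 hs] := analytic_maps_small r0 hG.
have hj := hs s s0 (lexx s).
apply/analyticP; exists s.
have [||c' hc'] := @tate_hsum p K n _ (fun a => nu (c a) * r ^+ mdeg a)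
  (fun a y => c a * monom (G y - G x) a) x s (fun y => F (G y)) s0 nul.
- move=> a; apply: tateM => //; first exact: abs_ge0.
  + by rewrite exprn_ge0 // ltW.
  + exact: tate_const.
  + rewrite /mdeg -prodrXr.
    have := @tate_prod p K n x s _ (index_enum _) (fun i => r ^+ a i)
      (fun i y => (G y 0 i - G x 0 i) ^+ a i) s0.
    have -> : (fun y => \prod_i (G y 0 i - G x 0 i) ^+ a i) = (fun y => monom (G y - G x) a).
      by apply/funext => y; apply: eq_bigr => i _; rewrite !mxE.
    apply=> i; first by rewrite exprn_ge0 // ltW.
    by apply: tateX => //; exact: ltW.
- move=> y yx; apply: hF => j.
  exact: tate_abs (ltW s0) (ltW r0) (hj j) yx.
by exists c'.
Qed.

(** * Uniqueness of power series expansions *)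

Section Uniqueness.
Hypothesis p_prime : prime p.

Lemma abs_p : nu p%:R = p%:R^-1.
Proof.
have -> : p%:R = ratr p%:Q :> K by rewrite ratr_nat.
rewrite (nu_rat (Qp_axiom K)) /padic_abs.
have p0 : (p%:Q == 0) = false by rewrite intr_eq0; have := prime_gt0 p_prime; case: (p).
rewrite p0 /= numq_int denq_int /= logn1 logn_prime // eqxx sub0r.
by rewrite exprN1.
Qed.

Lemma abs_p_lt1 : 0 < nu p%:R < 1.
Proof.
have p1 : 1 < (p%:R : rat) by rewrite ltr1n prime_gt1.
by rewrite abs_p invr_gt0 invf_lt1 ?p1 ?andbT //; lra.
Qed.

Lemma exists_small (e : rat) : 0 < e -> exists2 t : K, t != 0 & nu t <= e.
Proof.
move=> e0; have /andP[p0 p1] := abs_p_lt1.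
have [N hN] := rat_expr_small (ltW p0) p1 e0.
exists (p%:R ^+ N); first by rewrite -abs_gt0 absX exprn_gt0.
by rewrite absX hN.
Qed.

(** Once the earlier coefficients vanish, the leading term [t ^+ m * u m] is balanced by terms of
    size at most [nu t ^+ m.+1 * B]; dividing by [t ^+ m] and letting [t] tend to 0 kills [u m]. *)
Lemma hsum_pow_zero (u : nat -> K) :
  (forall t, nu t <= 1 -> hsum (fun m => t ^+ m * u m) 0) -> forall m, u m = 0.
Proof.
move=> h; have h1 : hsum u 0.
  by have := h 1; rewrite abs1 => /(_ (lexx _)); apply: eq_hsum => m; rewrite expr1n mul1r.
have [B B0 hB] := null_bounded (hsum_null h1).
elim/ltn_ind => m ih; apply: abs_eq0_eps => e e0.
have [t t0 te] : exists2 t : K, t != 0 & nu t <= Num.min 1 (e / B).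
  by apply: exists_small; rewrite lt_min ltr01 divr_gt0.
move: te; rewrite le_min => /andP[t1 te].
have nt : 0 < nu t by rewrite abs_gt0.
have := @hsum_tail _ _ _ _ _ [:: m] (nu t ^+ m.+1 * B) _ (h t t1) isT.
rewrite big_seq1 subr0 absM absX exprSr -mulrA ler_pM2l ?exprn_gt0 //.
move=> H; apply: le_trans (H _ _) _; last by rewrite -ler_pdivlMr.
  by rewrite !mulr_ge0 ?exprn_ge0 // ltW.
move=> j; rewrite inE => jm; case: (ltngtP j m) => [/ih->|mj|jm']; last by rewrite jm' eqxx in jm.
  by rewrite mulr0 abs0 !mulr_ge0 ?exprn_ge0 // ltW.
rewrite absM absX mulrA -exprSr; apply: ler_pM; rewrite ?abs_ge0 ?exprn_ge0 ?abs_ge0 //.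
by apply: ler_wiXn2l => //; exact: ltW.
Qed.

Variable n : nat.
Local Notation mi := (mi n).
Implicit Types (x y z : 'rV[K]_n) (a b : mi) (c d : mi -> K) (r s e : rat) (F G : 'rV[K]_n -> K).

Let vanishes r c := forall z, (forall i, nu (z 0 i) <= r) -> hsum (fun a => c a * monom z a) 0.

(* Rescaling one variable isolates the part of given degree in it. *)
Let vanishes_part r c k m : vanishes r c -> vanishes r (fun a => if a k == m then c a else 0).
Proof.
move=> hc z hz; have h0 := hc z hz.
have hU j : exists S, hsum (fun a => if a k == j then c a * monom z a else 0) S.
  apply: hsum_exists; apply: null_le (hsum_null h0) => a.
  by case: ifP => // _; rewrite abs0 abs_ge0.
have [U {}hU] := choice hU.
suff U0 : forall j, U j = 0.
  by have := hU m; rewrite U0; apply: eq_hsum => a; case: ifP; rewrite ?mul0r.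
apply: hsum_pow_zero => t t1.
pose zt : 'rV[K]_n := \row_i (if i == k then t * z 0 i else z 0 i).
have hzt : forall i, nu (zt 0 i) <= r.
  move=> i; rewrite mxE; case: ifP => // _; rewrite absM; apply: le_trans (hz i).
  by rewrite -[leRHS]mul1r ler_wpM2r ?abs_ge0.
have mzt a : monom zt a = t ^+ a k * monom z a.
  rewrite /monom (bigD1 k) //= [in RHS](bigD1 k) //= mxE eqxx exprMn -!mulrA.
  by congr (_ * (_ * _)); apply: eq_bigr => i /negPf ik; rewrite mxE ik.
apply: (hsum_fibre (phi := fun a : mi => a k)) (hc zt hzt) => j.
have := hsumZ (t ^+ j) (hU j); apply: eq_hsum => a; case: eqP => [<-|_]; last by rewrite mulr0.
by rewrite mzt mulrCA.
Qed.

(** Isolating the exponent of [a0] in each variable in turn leaves the single term of multi-index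
    [a0], which is evaluated at a point of the ball with all coordinates equal to some [t != 0]. *)
Lemma expands_unique0 x r c : 0 < r -> expands x r c (fun=> 0) -> c = fun=> 0.
Proof.
move=> r0 [_ hc]; apply/funext => a0.
have v0 : vanishes r c.
  move=> z hz; have : cball x r (x + z) by apply/cballE; rewrite addrC addKr.
  by move/hc; rewrite addrC addKr.
have vs (t : seq 'I_n) : vanishes r (fun a => if all (fun k => a k == a0 k) t then c a else 0).
  elim: t => [|k t ih] //=.
  move=> z hz; have := vanishes_part k (a0 k) ih hz; apply: eq_hsum => a.
  by case: (a k == a0 k).
have [t t0 tr] := exists_small r0.
have := vs (enum 'I_n) (const_mx t); have hct : forall i, nu ((const_mx t : 'rV[K]_n) 0 i) <= r.
  by move=> i; rewrite mxE.
move/(_ hct) => h.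
have aE a : all (fun k => a k == a0 k) (enum 'I_n) = (a == a0).
  apply/allP/eqP => [hh|-> //]; apply/ffunP => k; apply/eqP/hh; by rewrite mem_enum.
have h2 : hsum (fun a => (if a == a0 then c a else 0) * monom (const_mx t : 'rV[K]_n) a)
   (c a0 * monom (const_mx t : 'rV[K]_n) a0).
  have := @hsum1 p K _ a0 (fun a => (if a == a0 then c a else 0) * monom (const_mx t : 'rV[K]_n) a).
  by rewrite eqxx; apply=> a /negPf->; rewrite mul0r.
have /eqP : c a0 * monom (const_mx t : 'rV[K]_n) a0 = 0.
  by apply: hsum_unique h2 _; apply: eq_hsum h => a; rewrite aE.
rewrite mulf_eq0 => /orP[/eqP//|]; rewrite /monom prodf_seq_eq0 => /hasP[i _].
by rewrite mxE expf_eq0 (negPf t0) andbF.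
Qed.

Lemma expands_unique x r c d F : 0 < r -> expands x r c F -> expands x r d F -> c = d.
Proof.
move=> r0 hc hd; have h := expandsD (ltW r0) hc (expandsZ (-1) hd).
have /(expands_unique0 r0) h0 : expands x r (fun a => c a + -1 * d a) (fun=> 0).
  by apply: expands_ext h => y _; rewrite mulN1r subrr.
by apply/funext => a; have := congr1 (@^~ a) h0; rewrite /= mulN1r => /subr0_eq.
Qed.

(** Uniqueness makes the choice of radius and series immaterial; where [F] is not analytic the value
    is the zero family. *)
Definition tcoef F x : mi -> K :=
  xget (fun=> 0) [set c | exists2 r, 0 < r & expands x r c F]%classic.

Lemma tcoefE x r c F : 0 < r -> expands x r c F -> tcoef F x = c.
Proof.
move=> r0 hF; rewrite /tcoef; case: xgetP => [d -> [s s0 hd]|/(_ c)]; last by case; exists r.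
have m0 : 0 < Num.min r s by rewrite lt_min r0.
apply: (expands_unique m0); [apply: expandsW hd | apply: expandsW hF] => //;
  by rewrite ge_min lexx ?orbT.
Qed.

Lemma tcoef_expands x F : analytic_at F x -> exists2 r, 0 < r & expands x r (tcoef F x) F.
Proof. by move=> /analyticP[r [c [r0 hc]]]; exists r => //; rewrite (tcoefE r0 hc). Qed.

Lemma tcoef_local x F G r : 0 < r -> (forall y, cball x r y -> F y = G y) -> analytic_at F x ->
  tcoef F x = tcoef G x.
Proof.
move=> r0 FG /tcoef_expands[s s0 hF].
have m0 : 0 < Num.min r s by rewrite lt_min r0.
rewrite (tcoefE (F := G) (c := tcoef F x) m0) //.
apply: expands_ext (expandsW m0 _ hF); last by rewrite ge_min lexx orbT.
by move=> y /cball_le h; apply: FG; apply: h; rewrite ge_min lexx.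
Qed.

Lemma tcoef_const x k : tcoef (fun=> k) x = fun a => if a == m0 n then k else 0.
Proof. exact: (tcoefE ltr01 (expands_const x 1 k)). Qed.

Lemma tcoef_coord x k :
  tcoef (fun y => y 0 k) x = fun a => (if a == m0 n then x 0 k else 0) + (if a == munit k 1 then 1 else 0).
Proof. exact: (tcoefE ltr01 (expands_coord x 1 k)). Qed.

Lemma tcoefD x F G : analytic_at F x -> analytic_at G x ->
  tcoef (fun y => F y + G y) x = fun a => tcoef F x a + tcoef G x a.
Proof.
move=> hF hG; have [r [c [d [r0 hc hd]]]] := analytic_common hF hG.
by rewrite (tcoefE r0 hc) (tcoefE r0 hd) (tcoefE r0 (expandsD (ltW r0) hc hd)).
Qed.

Lemma tcoefZ x k F : analytic_at F x -> tcoef (fun y => k * F y) x = fun a => k * tcoef F x a.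
Proof. by move=> /tcoef_expands[r r0 hc]; rewrite (tcoefE r0 (expandsZ k hc)). Qed.

(** Both summands of a multi-index with entries below [N] have entries below [N], so the Cauchy
    product is a finite sum within the cube. *)
Lemma tcoefM x F G N (f : {ffun 'I_n -> 'I_N}) : analytic_at F x -> analytic_at G x ->
  tcoef (fun y => F y * G y) x (mbox f) =
  \sum_(g : {ffun 'I_n -> 'I_N}) \sum_(h : {ffun 'I_n -> 'I_N})
    if madd (mbox g) (mbox h) == mbox f then tcoef F x (mbox g) * tcoef G x (mbox h) else 0.
Proof.
move=> hF hG; have [r [c [d [r0 hc hd]]]] := analytic_common hF hG.
have [C [hC h _]] := expandsM r0 hc hd.
rewrite (tcoefE r0 hc) (tcoefE r0 hd) (tcoefE r0 hC).
pose u (ab : mi * mi) := if madd ab.1 ab.2 == mbox f then c ab.1 * d ab.2 else 0.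
have := @hsum_fin p K _ u [seq (a, b) | a <- box n N, b <- box n N] _ _.
rewrite big_allpairs big_box; under eq_bigr do rewrite big_box.
move=> H; apply: hsum_unique (h (mbox f)) (H _ _).
  by rewrite allpairs_uniq ?box_uniq // => -[? ?] [? ?] _ _ /= [-> ->].
move=> [a b] hab; rewrite /u /=; case: eqP => // e; case/negP: hab.
apply/allpairsP; exists (a, b); split=> //; apply: mem_box => i;
 apply: leq_ltn_trans (ltn_ord (f i)); have /ffunP/(_ i) := e; rewrite !ffunE => <-;
 by rewrite ?leq_addr ?leq_addl.
Qed.

End Uniqueness.
End AnalyticFunctions.

(** * Hasse derivatives *)

Section Taylor.
Variables (p : nat) (K : padicField p).
Local Notation nu := (@Qp_abs p K).

Section Dim.
Variable n : nat.
Local Notation mi := (mi n).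
Implicit Types (x y z : 'rV[K]_n) (a b : mi) (c d : mi -> K) (r s e : rat) (F G : 'rV[K]_n -> K).

Lemma monom_binomial (u v : 'rV[K]_n) a N : (forall i, (a i < N)%N) ->
  monom (u + v) a = \sum_(b <- box n N) (mbin a b)%:R * monom u (msub a b) * monom v b.
Proof.
move=> aN; rewrite big_box /monom.
have h i : (u + v) 0 i ^+ a i = \sum_(j < N) ('C(a i, j))%:R * u 0 i ^+ (a i - j) * v 0 i ^+ j.
  rewrite mxE exprDn (big_ord_widen _ (fun j => u 0 i ^+ (a i - j) * v 0 i ^+ j *+ 'C(a i, j)) (aN i)).
  rewrite big_mkcond; apply: eq_bigr => j _; case: ltnP => [_|ji]; first by rewrite -mulr_natl mulrA.
  by rewrite bin_small // mul0r mul0r.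
under eq_bigr do rewrite h; rewrite bigA_distr_bigA; apply: eq_bigr => f _ /=.
rewrite /mbin natr_prod -!big_split /=; apply: eq_bigr => i _.
by rewrite !ffunE.
Qed.

Lemma hsum_monom_binomial (u v : 'rV[K]_n) a :
  hsum (fun b => (mbin a b)%:R * monom u (msub a b) * monom v b) (monom (u + v) a).
Proof.
have aN i : (a i < (mdeg a).+1)%N by rewrite ltnS mle_deg.
rewrite (monom_binomial _ _ aN); apply: hsum_fin; first exact: box_uniq.
move=> b hb; rewrite mbin0 ?mul0r //; apply: contra hb => /forallP hb.
by apply: mem_box => i; apply: leq_ltn_trans (hb i) (aN i).
Qed.

(** Binomial coefficients are integers, of absolute value at most 1. This is why moving the centre
    within the ball costs no radius. *)
Lemma abs_hasse_le x r y k a b : 0 <= r -> cball x r y ->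
  nu (k * ((mbin a b)%:R * monom (y - x) (msub a b))) * r ^+ mdeg b <= nu k * r ^+ mdeg a.
Proof.
move=> r0 /cballE yx.
case: (boolP (mle b a)) => [ba|/mbin0->]; last first.
  by rewrite mul0r mulr0 abs0 mul0r mulr_ge0 ?abs_ge0 ?exprn_ge0.
rewrite !absM -mulrA; apply: ler_wpM2l; first exact: abs_ge0.
have -> : mdeg a = (mdeg (msub a b) + mdeg b)%N by rewrite -mdegD msubK.
rewrite exprD; apply: ler_wpM2r; first exact: exprn_ge0.
rewrite -[leRHS]mul1r; apply: ler_pM; rewrite ?abs_ge0 ?abs_nat_le1 //.
exact: abs_monom_le.
Qed.

(** [D b y] is the Hasse derivative, the sum over [a] of [C(a, b) c_a (y - x)^(a - b)]. Every point
    of an ultrametric ball is a centre of it, so the expansion at [y] is valid on the same ball. *)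
Lemma expands_hasse x r c F : 0 < r -> expands x r c F ->
  exists D : mi -> 'rV[K]_n -> K, (forall b, exists d, expands x r d (D b)) /\
    forall y, cball x r y -> expands y r (fun b => D b y) F.
Proof.
move=> r0 [nul hF]; have r0' := ltW r0.
have nb b : null_family (fun a => nu (c a * (mbin a b)%:R) * r ^+ mdeg (msub a b)).
  have rb : 0 < r ^+ mdeg b by rewrite exprn_gt0.
  have rb' : 0 <= (r ^+ mdeg b)^-1 by rewrite invr_ge0 ltW.
  apply: null_le (null_scale rb' nul) => a.
  rewrite ler_pdivlMl //.
  case: (boolP (mle b a)) => [ba|/mbin0->]; last first.
    by rewrite mulr0 abs0 mul0r mulr0 mulr_ge0 ?abs_ge0 ?exprn_ge0.
  rewrite mulrCA -exprD addnC -mdegD msubK //; apply: ler_wpM2r; first exact: exprn_ge0.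
  by rewrite absM -[leRHS]mulr1 ler_wpM2l ?abs_ge0 ?abs_nat_le1.
have /choice[D hD] : forall b, exists D : 'rV[K]_n -> K, forall y, cball x r y ->
    hsum (fun a => c a * (mbin a b)%:R * monom (y - x) (msub a b)) (D y).
  by move=> b; apply: (hsum_fun (phi := fun a => msub a b)) r0' (nb b).
exists D; split=> [b|y yx].
  have [C [hC _ _]] := expands_regroup r0 (nb b) (hD b).
  by exists C.
(* Weighted by [monom (z - y) b], this family summed over [b] gives the term [a] of the expansion at
   [x], by the binomial theorem. Summed over [a] without the weight it gives [D b y]. *)
pose u (ab : mi * mi) := c ab.1 * ((mbin ab.1 ab.2)%:R * monom (y - x) (msub ab.1 ab.2)).
have nu_u : null_family (fun ab => nu (u ab) * r ^+ mdeg ab.2).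
  apply: (null_pair nul) => [a|[a b]]; last exact: abs_hasse_le.
  apply: (null_finite (s := box n (mdeg a).+1)) => b hb; rewrite /u /= mbin0 ?mul0r ?mulr0 ?abs0 ?mul0r //.
  apply: contra hb => /forallP hb.
  by apply: mem_box => i; apply: leq_ltn_trans (hb i) _; rewrite ltnS mle_deg.
have [|C [hC hC2 _]] := @expands_regroup p K n (mi * mi)%type snd u y r F r0 nu_u.
- move=> z zy; have zx := cball_trans yx zy.
  apply: (fubini_pair (b := fun a => c a * monom (z - x) a)) => [|a|]; last exact: hF.
    by apply: null_le nu_u => ab; apply: abs_term_le.
  have := hsumZ (c a) (hsum_monom_binomial (y - x) (z - y) a).
  by rewrite [y - x + _]addrC subrKA; apply: eq_hsum => b; rewrite /u /= !mulrA.
suff -> : (fun b => D b y) = C by [].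
apply/funext => b; apply: hsum_unique (hD b y yx) _.
apply: (@fubini_l p K _ _ _ _ _ _ (hC2 b)) => a /=.
have := @hsum1 p K _ b (fun b' => if b' == b then u (a, b') else 0).
rewrite eqxx /u /= mulrA; apply=> b' /negPf -> //.
Qed.

Lemma expands_analytic x r c F y : 0 < r -> expands x r c F -> cball x r y -> analytic_at F y.
Proof.
move=> r0 hF yx; have [D [_ h]] := expands_hasse r0 hF.
by apply/analyticP; exists r, (fun b => D b y); split=> //; exact: h.
Qed.

Lemma tcoef_analytic (p_prime : prime p) F x b : analytic_at F x ->
  analytic_at (fun y => tcoef F y b) x.
Proof.
move=> /analyticP[r [c [r0 hF]]]; have [D [hD h]] := expands_hasse r0 hF.
have [d hd] := hD b.
apply: (@analytic_local p K n (D b) _ x r r0).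
  by move=> y yx; rewrite (tcoefE p_prime r0 (h y yx)).
by apply/analyticP; exists r, d.
Qed.

(* A monomial outside the box is divisible by the N-th power of a variable. *)
Lemma expands_hadamard N x r c F : 0 < r -> expands x r c F ->
  exists g : 'I_n -> 'rV[K]_n -> K, (forall k, exists d, expands x r d (g k)) /\
    forall y, cball x r y ->
      F y = \sum_(f : {ffun 'I_n -> 'I_N}) c (mbox f) * monom (y - x) (mbox f) +
            \sum_k (y 0 k - x 0 k) ^+ N * g k y.
Proof.
move=> r0 [nul hF].
(* A multi-index outside the cube may have several large entries; [pk] selects one, so that each
   such term is counted in exactly one [g k]. *)
pose pk (a : mi) := [pick k | (N <= a k)%N].
pose ck k a := if pk a == Some k then c a else 0.
have pkP a k : pk a = Some k -> madd (msub a (munit k N)) (munit k N) = a.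
  by rewrite /pk; case: pickP => // k' hk [<-]; apply: msubK; rewrite mle_munit.
have nk k : null_family (fun a => nu (ck k a) * r ^+ mdeg (msub a (munit k N))).
  have rb : 0 < r ^+ N by rewrite exprn_gt0.
  have rb' : 0 <= (r ^+ N)^-1 by rewrite invr_ge0 ltW.
  apply: null_le (null_scale rb' nul) => a.
  rewrite ler_pdivlMl // /ck.
  case: eqP => [/pkP e|_]; last by rewrite abs0 mul0r mulr0 mulr_ge0 ?abs_ge0 ?exprn_ge0 ?ltW.
  by rewrite mulrCA -exprD -[X in r ^+ (X + _)](mdeg_unit k) addnC -mdegD e.
have /choice[g hg] : forall k, exists g : 'rV[K]_n -> K, forall y, cball x r y ->
    hsum (fun a => ck k a * monom (y - x) (msub a (munit k N))) (g y).
  by move=> k; apply: (hsum_fun (phi := fun a => msub a (munit k N))) (ltW r0) (nk k).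
exists g; split=> [k|y yx].
  have [C [hC _ _]] := expands_regroup r0 (nk k) (hg k).
  by exists C.
pose u a := if a \in box n N then c a * monom (y - x) a else 0.
have hu : hsum u (\sum_(f : {ffun 'I_n -> 'I_N}) c (mbox f) * monom (y - x) (mbox f)).
  rewrite -(big_box (R := K) N (fun a => c a * monom (y - x) a)).
  rewrite (_ : \sum_(a <- _) _ = \sum_(a <- box n N) u a).
    by apply: hsum_fin; [exact: box_uniq | move=> a /negPf; rewrite /u => ->].
  by rewrite [LHS]big_seq [RHS]big_seq; apply: eq_bigr => a; rewrite /u => ->.
have hk k : hsum (fun a => ck k a * monom (y - x) a) ((y 0 k - x 0 k) ^+ N * g k y).
  have := hsumZ ((y 0 k - x 0 k) ^+ N) (hg k y yx); apply: eq_hsum => a.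
  rewrite /ck; case: eqP => [/pkP e|_]; last by rewrite !mul0r mulr0.
  rewrite mulrCA; congr (_ * _); rewrite -[in RHS]e monomD monom_unit mulrC.
  by rewrite !mxE.
have := hsumD hu (hsum_sum (index_enum _) hk); apply: hsum_unique.
have := hF y yx; apply: eq_hsum => a.
rewrite /u; case: (boolP (a \in box n N)) => [ab|ab].
  rewrite big1 ?addr0 // => k _; rewrite /ck /pk; case: pickP => [k' hk'|]; last by rewrite mul0r.
  move: ab => /mapP[f _ af]; move: hk'; rewrite af ffunE leqNgt ltn_ord //.
have [k hpk] : exists k, pk a = Some k.
  rewrite /pk; case: pickP => [k _|h]; first by exists k.
  case/negP: ab; apply: mem_box => i; have := h i; rewrite leqNgt => /negbFE //.
rewrite add0r (bigD1 k) //= /ck hpk eqxx big1 ?addr0 // => k' /negPf kk.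
by rewrite (_ : (Some k == Some k') = false) ?mul0r // -kk eq_sym.
Qed.

End Dim.

(** * Taylor coefficients in a part of the variables *)

Section Slice.
Variables (m n : nat).

Definition mslice (b : mi n) : mi (m + n) :=
  [ffun i => match split i with inl _ => 0%N | inr j => b j end].

Definition mres (a : mi (m + n)) : mi n := [ffun j => a (rshift m j)].

Lemma msliceK : cancel mslice mres.
Proof.
move=> b; apply/ffunP => j; rewrite !ffunE.
by case: splitP => [k /= h|k /= /addnI/val_inj <- //]; have := ltn_ord k; rewrite -h; lia.
Qed.

Lemma mslice_l b j : mslice b (lshift n j) = 0%N.
Proof. by rewrite ffunE -[lshift n j]/(unsplit (inl j)) unsplitK. Qed.

Lemma mslice_r b j : mslice b (rshift m j) = b j.
Proof. by rewrite ffunE -[rshift m j]/(unsplit (inr j)) unsplitK. Qed.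

Lemma mdeg_slice b : mdeg (mslice b) = mdeg b.
Proof.
rewrite /mdeg big_split_ord /= big1 => [|i _]; last exact: mslice_l.
by rewrite add0n; apply: eq_bigr => i _; rewrite mslice_r.
Qed.

Lemma row_mx_sub (g : 'rV[K]_m) (z x : 'rV[K]_n) : row_mx g z - row_mx g x = row_mx 0 (z - x).
Proof. by rewrite opp_row_mx add_row_mx subrr. Qed.

Lemma monom_slice (g : 'rV[K]_m) (z x : 'rV[K]_n) b :
  monom (row_mx g z - row_mx g x) (mslice b) = monom (z - x) b.
Proof.
rewrite row_mx_sub /monom big_split_ord /= big1 => [|i _]; last by rewrite mslice_l expr0.
by rewrite mul1r; apply: eq_bigr => i _; rewrite mslice_r row_mxEr.
Qed.

Lemma monom_slice0 (g : 'rV[K]_m) (z x : 'rV[K]_n) a : mslice (mres a) != a ->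
  monom (row_mx g z - row_mx g x) a = 0.
Proof.
move=> ha; have /existsP[i hi] : [exists i : 'I_m, a (lshift n i) != 0%N].
  rewrite -negb_forall; apply: contra ha => /forallP h; apply/eqP/ffunP => j.
  rewrite -[j]splitK; case: (split j) => k /=.
    by rewrite mslice_l; have /eqP-> := h k.
  by rewrite mslice_r ffunE.
by rewrite row_mx_sub /monom (bigD1 (lshift n i)) //= row_mxEl mxE expr0n (negPf hi) mul0r.
Qed.

(** With the first [m] variables frozen at the centre, every monomial involving them vanishes. The
    right-hand side is a Taylor coefficient in all variables, so it depends analytically on [g] and
    [x] together. *)
Lemma tcoef_slice (p_prime : prime p) (F : 'rV[K]_(m + n) -> K) (g : 'rV[K]_m) (x : 'rV[K]_n) :
  analytic_at F (row_mx g x) ->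
  tcoef (fun z => F (row_mx g z)) x = fun b => tcoef F (row_mx g x) (mslice b).
Proof.
move=> /(tcoef_expands p_prime)[r r0 [nul h]]; apply: (tcoefE p_prime r0); split.
  have := null_inj msliceK nul; apply: null_le => b.
  by rewrite /= mdeg_slice.
move=> z zx; have zx' : cball (row_mx g x) r (row_mx g z).
  move=> i; rewrite -[i]splitK; case: (split i) => k /=.
    by rewrite !row_mxEl subrr abs0 ltW.
  by rewrite !row_mxEr; exact: zx.
have h0 a : mslice (mres a) != a ->
    tcoef F (row_mx g x) a * monom (row_mx g z - row_mx g x) a = 0.
  by move=> ha; rewrite monom_slice0 ?mulr0.
by apply: eq_hsum (hsum_inj msliceK h0 (h _ zx')) => b; rewrite monom_slice.
Qed.

End Slice.

End Taylor.

(** * Compactness of balls and topology of manifolds *)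

Section Compactness.
Variables (p : nat) (K : padicField p).
Hypothesis p_prime : prime p.
Local Notation nu := (@Qp_abs p K).

Lemma abs_int_le1 (m : int) : nu m%:~R <= 1.
Proof. by case: m => m; rewrite ?NegzE ?mulrNz ?absN -pmulrn abs_nat_le1. Qed.

(** By Bezout, [nu m < 1] together with [nu p < 1] would give [nu 1 < 1]. *)
Lemma abs_int_coprime (m : int) : coprimez m p -> nu m%:~R = 1.
Proof.
move=> /coprimezP[[u v] /= uv]; apply/eqP; rewrite eq_le abs_int_le1 /= leNgt; apply/negP => m1.
have := abs1 K; have <- : (u * m + v * p)%:~R = 1 :> K by rewrite uv.
move/eqP; rewrite eq_le => /andP[_]; rewrite leNgt => /negP; apply.
rewrite rmorphD !rmorphM /=; have /andP[_ p1] := abs_p_lt1 K p_prime.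
apply: le_lt_trans (nuD_max (Qp_axiom K) _ _) _.
rewrite gt_max !absM; apply/andP; split.
  by apply: le_lt_trans m1; rewrite -[leRHS]mul1r ler_wpM2r ?abs_ge0 ?abs_int_le1.
by apply: le_lt_trans p1; rewrite -[leRHS]mul1r ler_wpM2r ?abs_ge0 ?abs_int_le1.
Qed.

(** Representatives of the integers of [K] modulo [p ^ k]: approximate [w] by a rational [q], whose
    denominator is prime to [p], then invert this denominator modulo [p ^ k]. *)
Lemma abs_le1_nat (w : K) k : nu w <= 1 ->
  exists2 i : nat, (i < p ^ k)%N & nu (w - i%:R) <= nu p%:R ^+ k.
Proof.
move=> w1; have /andP[p0 p1] := abs_p_lt1 K p_prime.
have pk0 : 0 < nu p%:R ^+ k by rewrite exprn_gt0.
have [q hq] := nu_dense (Qp_axiom K) w pk0.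
have q1 : nu (ratr q) <= 1.
  rewrite -[ratr q](subKr w); apply: absB_le => //; apply: le_trans (ltW hq) _.
  by rewrite exprn_ile1 // ltW.
set m := numq q; set d := denq q.
(* The absolute value of the image of [d] is prescribed by [nu_rat], and it is nonzero. *)
have d0 : d%:~R != 0 :> K.
  have /negP dq := denq_neq0 q; apply/negP => /eqP h; move: q1.
  have /eqP : nu (ratr d%:Q) = 0 by rewrite ratr_int h abs0.
  rewrite (nu_rat (Qp_axiom K)) /padic_abs intr_eq0 (negPf (denq_neq0 q)).
  rewrite expfz_eq0 => /andP[_]; rewrite intr_eq0 => /eqP[e] _; have := prime_gt0 p_prime.
  by rewrite e.
have qE : ratr q = m%:~R / d%:~R :> K by [].
(* If [p] divided [d] it would not divide [m], and [q] would have absolute value [1 / nu d > 1]. *)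
have cop : coprimez d p.
  rewrite coprimez_sym; apply: contraLR q1; rewrite -ltNge => pd.
  have pd' : (p %| `|d|)%N by move: pd; rewrite coprimezE prime_coprime // negbK.
  have cmp : coprimez m p.
    rewrite coprimez_sym coprimezE prime_coprime //.
    apply/negP => pm; have := coprime_num_den q; rewrite -/m -/d => c.
    have : (p %| gcdn `|m| `|d|)%N by rewrite dvdn_gcd pm.
    by move: c; rewrite /coprime => /eqP ->; rewrite dvdn1 => /eqP pp; move: p_prime; rewrite pp.
  rewrite qE absM absV abs_int_coprime // mul1r invf_gt1 ?abs_gt0 //.
  apply: le_lt_trans p1; have /dvdzP[t ->] : (p %| d)%Z by [].
  by rewrite rmorphM absM /= -[leRHS]mul1r ler_wpM2r ?abs_ge0 ?abs_int_le1.
have nd : nu d%:~R = 1 by exact: abs_int_coprime.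
have : coprimez d (p%:Z ^+ k) by rewrite coprimezXr.
move=> /coprimezP[[u v] /= uv].
have pk : (p%:Z ^+ k) != 0 by rewrite expf_neq0 //; have := prime_gt0 p_prime; case: (p).
(* [u] inverts [d] modulo [p ^ k], so [i] is the residue of [m / d]. *)
pose i := ((m * u) %% (p%:Z ^+ k))%Z.
have i0 : 0 <= i by exact: modz_ge0.
have ilt : i < p%:Z ^+ k by rewrite ltz_pmod // lt_neqAle eq_sym pk exprn_ge0.
have iE : m - i * d = p%:Z ^+ k * (m * v + ((m * u) %/ (p%:Z ^+ k))%Z * d).
  have := divz_eq (m * u) (p%:Z ^+ k); rewrite -/i; set t := (_ %/ _)%Z => h.
  have -> : i = m * u - t * p%:Z ^+ k by rewrite h; ring.
  by rewrite -{1}[m]mulr1 -uv; ring.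
exists `|i|%N.
  by rewrite -(ltr_nat int) natrX !natz gez0_abs.
rewrite -(subrKA (ratr q)); apply: absD_le; first exact: ltW.
have -> : ratr q - `|i|%:R = (m - i * d)%:~R / d%:~R :> K.
  rewrite qE rmorphB rmorphM /= mulrBl mulfK //; congr (_ - _).
  by rewrite -{2}(gez0_abs i0) pmulrn.
rewrite absM absV nd invr1 mulr1 iE rmorphM /= absM rmorphXn /= absX -[leRHS]mulr1 ler_wpM2l ?exprn_ge0 ?abs_ge0 //.
exact: abs_int_le1.
Qed.

(** Multiplication by [p ^ m] with [nu p ^ m <= 1 / r] carries the ball into the unit ball. Dividing
    back costs a factor [nu p ^ m], which is absorbed in the choice of [k]. *)
Lemma totally_bounded (r e : rat) : 0 < r -> 0 < e ->
  exists s : seq K, forall w, nu w <= r -> exists2 u, u \in s & nu (w - u) <= e.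
Proof.
move=> r0 e0; have /andP[p0 p1] := abs_p_lt1 K p_prime.
have ri : 0 < r^-1 by rewrite invr_gt0.
have [m hm] := rat_expr_small (ltW p0) p1 ri.
have pm0 : 0 < nu p%:R ^+ m by rewrite exprn_gt0.
have [k hk] := rat_expr_small (ltW p0) p1 (mulr_gt0 e0 pm0).
exists [seq i%:R / p%:R ^+ m | i <- iota 0 (p ^ k)] => w wr.
have [|i ik hi] := @abs_le1_nat (w * p%:R ^+ m) k.
  rewrite absM absX; apply: le_trans (ler_pM (abs_ge0 _) (ltW pm0) wr (hm m (leqnn m))) _.
  by rewrite divff // gt_eqF.
exists (i%:R / p%:R ^+ m); first by apply/mapP; exists i; rewrite // mem_iota.
have pn0 : p%:R ^+ m != 0 :> K by rewrite expf_neq0 // -abs_gt0.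
have -> : w - i%:R / p%:R ^+ m = (w * p%:R ^+ m - i%:R) / p%:R ^+ m by rewrite mulrBl mulfK.
by rewrite absM absV absX ler_pdivrMr //; apply: le_trans hi (hk k (leqnn k)).
Qed.

Lemma cball_cover n (x : 'rV[K]_n) (r e : rat) : 0 < r -> 0 < e ->
  exists s : seq 'rV[K]_n, forall w, cball x r w -> exists2 u, u \in s & cball u e w.
Proof.
move=> r0 e0; have [s hs] := totally_bounded r0 e0.
pose row_of (f : {ffun 'I_n -> 'I_(size s)}) : 'rV[K]_n := \row_i (x 0 i + s`_(f i)).
exists [seq row_of f | f <- enum {: {ffun 'I_n -> 'I_(size s)}}] => w wx.
have /choice[f hf] : forall i, exists j : 'I_(size s), nu (w 0 i - x 0 i - s`_j) <= e.
  by move=> i; have [u us h] := hs _ (wx i); move: (us); rewrite -index_mem => us'; exists (Ordinal us'); rewrite /= nth_index.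
exists (row_of [ffun i => f i]); first by apply: map_f; rewrite mem_enum.
by move=> i; rewrite mxE ffunE opprD addrA.
Qed.

(** Compactness as an induction principle on sets. If [P] failed, total boundedness would give
    nested sets without [P], the one of index [k + 1] inside a ball of radius [1 / (k + 1)]. Points
    chosen in them converge to some [L] in the ball, and a ball around [L] satisfying [P] contains
    one of these sets. *)
Lemma cball_compact n (x : 'rV[K]_n) (r : rat) (P : set 'rV[K]_n -> Prop) : 0 < r ->
  P set0 -> (forall A B, P A -> P B -> P (A `|` B)%classic) ->
  (forall A B, (A `<=` B)%classic -> P B -> P A) ->
  (forall w, cball x r w -> exists2 e : rat, 0 < e & P (cball w e)) -> P (cball x r).
Proof.
move=> r0 P0 PU Psub Ploc; apply: contrapT => nP.
pose e (k : nat) : rat := k.+1%:R^-1.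
have e0 k : 0 < e k by rewrite invr_gt0 ltr0n.
have step (S : {S : set 'rV[K]_n | ~ P S /\ (S `<=` cball x r)%classic}) (k : nat) :
    exists u, ~ P (sval S `&` cball u (e k))%classic.
  case: S => S [nS Sx] /=; apply/existsNP => h; apply: nS.
  have [s hs] := cball_cover x r0 (e0 k).
  apply: (Psub _ [set w | exists2 u, u \in s & (S `&` cball u (e k)) w]%classic).
    by move=> w Sw; have [u us uw] := hs w (Sx w Sw); exists u.
  elim: s {hs} => [|u s ih]; first by apply: Psub P0 => w [].
  apply: Psub (PU _ _ (h u) ih) => w [u']; rewrite inE => /orP[/eqP->|us] hw; [by left|by right; exists u'].
pose T := {S : set 'rV[K]_n | ~ P S /\ (S `<=` cball x r)%classic}.
have cu (S : T) k : {u | ~ P (sval S `&` cball u (e k))%classic} by exact/cid/step.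
have sub (S : T) k : (sval S `&` cball (sval (cu S k)) (e k) `<=` cball x r)%classic.
  by move=> w [Sw _]; exact: (svalP S).2.
pose nxt k (S : T) : T := exist _ (sval S `&` cball (sval (cu S k)) (e k))%classic
   (conj (svalP (cu S k)) (sub S k)).
pose Sq : nat -> T := fix rec k := if k is k'.+1 then nxt k' (rec k') else
  exist _ (cball x r) (conj nP (fun w h => h)).
have Sne k : exists w, sval (Sq k) w.
  apply/not_existsP => h; apply: (svalP (Sq k)).1; apply: Psub P0 => w Sw.
  by have := h w.
have [w hw] := choice Sne.
pose u k := sval (cu (Sq k) k).
have mono k j : (k <= j)%N -> (sval (Sq j) `<=` sval (Sq k))%classic.
  by move=> /subnK <-; elim: (j - k)%N => [//|i ih] z [/ih].
have Su k : (sval (Sq k.+1) `<=` cball (u k) (e k))%classic by move=> z [].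
have arch (d : rat) : 0 < d -> exists N, forall k, (N <= k)%N -> e k <= d.
  move=> dp; exists (Num.bound d^-1) => k Nk; rewrite invf_ple ?posrE ?ltr0n //.
  have di0 : 0 <= d^-1 by rewrite invr_ge0 ltW.
  by apply: le_trans (ltW (archi_boundP di0)) _; rewrite ler_nat ltnW.
have cvg i : exists l, forall d : rat, 0 < d -> exists N, forall j, (N <= j)%N -> nu (w j 0 i - l) < d.
  apply: (nu_complete (Qp_axiom K)) => d dp; have d2 : 0 < d / 2 by lra.
  have [N hN] := arch _ d2; exists N.+1 => j k Nj Nk.
  have uj : cball (u N) (e N) (w j) by apply: Su; apply: (mono _ _ Nj).
  have uk : cball (u N) (e N) (w k) by apply: Su; apply: (mono _ _ Nk).
  have := cball_trans (cball_sym uk) uj i; move=> /le_lt_trans; apply.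
  by apply: le_lt_trans (hN N (leqnn N)) _; lra.
have [l hl] := choice cvg.
pose L : 'rV[K]_n := \row_i l i.
have closed z d k : 0 < d -> (forall j, (k <= j)%N -> cball z d (w j)) -> cball z d L.
  move=> dp h i; have [N hN] := hl i _ dp; pose j := maxn N k.
  rewrite mxE -(subrKA (w j 0 i)); apply: absD_le; last by apply: h; rewrite leq_maxr.
  by rewrite absBC ltW // hN // leq_maxl.
have Lx : cball x r L by apply: (closed x r 0%N) => // j _; apply: (svalP (Sq j)).2.
have [d dp PL] := Ploc L Lx; have [k hk] := arch _ dp.
apply: (svalP (Sq k.+1)).1; apply: Psub PL => z /Su uz.
have uL : cball (u k) (e k) L.
  by apply: (closed _ _ k.+1) => // j kj; apply: Su; apply: (mono _ _ kj).
apply: cball_le (hk k (leqnn k)) _; exact: cball_trans (cball_sym uL) uz.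
Qed.

End Compactness.

(** * Open sets and analytic functions of a manifold, read in charts *)

Section Manifold.
Local Open Scope classical_set_scope.
Variables (p : nat) (K : padicField p) (M : Type) (AM : atlas K M).
Hypothesis M_manifold : is_manifold AM.
Local Notation nu := (@Qp_abs p K).
Implicit Types (c d : chart K M) (x y : M) (U V W : set M) (f g : M -> K).

Lemma mopenT : mopen AM setT.
Proof. by move=> c Ac; rewrite setIT -[X in _ @` X]setIid; apply: (mfd_open M_manifold). Qed.

Lemma mopen_cdom d : AM d -> mopen AM (cdom d).
Proof. by move=> Ad c Ac; apply: (mfd_open M_manifold). Qed.

Lemma mopenI U V : mopen AM U -> mopen AM V -> mopen AM (U `&` V).
Proof.
move=> oU oV c Ac _ [y [cy [Uy Vy]] <-].
have [r r0 hr] := oU c Ac (cmap c y) (ex_intro2 _ _ y (conj cy Uy) erefl).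
have [s s0 hs] := oV c Ac (cmap c y) (ex_intro2 _ _ y (conj cy Vy) erefl).
exists (Num.min r s); first by rewrite lt_min r0.
move=> z hz.
have [|y1 [cy1 Uy1] e1] := hr z; first by apply: cball_le hz; rewrite ge_min lexx.
have [|y2 [cy2 Vy2] e2] := hs z; first by apply: cball_le hz; rewrite ge_min lexx orbT.
exists y1 => //; split=> //; split=> //.
by rewrite (mfd_inj M_manifold Ac cy1 cy2) // e1.
Qed.

Lemma mopen_local U : (forall y, U y -> exists W, [/\ mopen AM W, W y & W `<=` U]) -> mopen AM U.
Proof.
move=> h c Ac _ [y [cy Uy] <-]; have [W [oW Wy WU]] := h y Uy.
have [r r0 hr] := oW c Ac (cmap c y) (ex_intro2 _ _ y (conj cy Wy) erefl).
by exists r => // z /hr[y' [cy' Wy'] <-]; exists y' => //; split=> //; apply: WU.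
Qed.

Lemma chart_ball d x W : AM d -> cdom d x -> mopen AM W -> W x ->
  exists2 r, 0 < r & forall z, cball (cmap d x) r z -> exists y, [/\ cdom d y, W y & cmap d y = z].
Proof.
move=> Ad dx oW Wx.
have [r r0 hr] := oW d Ad (cmap d x) (ex_intro2 _ _ x (conj dx Wx) erefl).
by exists r => // z /hr[y [dy Wy] <-]; exists y.
Qed.

(* f read in the chart d, and 0 outside the image of the chart. *)
Definition cpull d f (z : 'rV[K]_(cdim d)) : K :=
  if pselect (exists y, cdom d y /\ cmap d y = z) is left h then f (projT1 (cid h)) else 0.

Lemma cpullE d f y : AM d -> cdom d y -> cpull f (cmap d y) = f y.
Proof.
move=> Ad dy; rewrite /cpull; case: pselect => [h|]; last by case; exists y.
by case: cid => /= y' [dy' e]; rewrite (mfd_inj M_manifold Ad dy' dy e).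
Qed.

(** Analyticity at a point without reference to a neighbourhood. The values 0 of [cpull] outside the
    chart do no harm, since the image of a chart is open. *)
Definition an_pt f x := forall c, AM c -> cdom c x -> analytic_at (@cpull c f) (cmap c x).

Lemma analytic_in_chartE d W f x : AM d -> cdom d x -> mopen AM W -> W x ->
  analytic_in_chart d W f x <-> analytic_at (@cpull d f) (cmap d x).
Proof.
move=> Ad dx oW Wx; split=> [[F hF aF]|h]; last first.
  by exists (@cpull d f) => // y dy _; rewrite cpullE.
have [r r0 hr] := chart_ball Ad dx oW Wx.
apply: analytic_local r0 _ aF => z /hr[y [dy Wy <-]].
by rewrite cpullE // hF.
Qed.

Lemma analytic_onE U f : mopen AM U -> analytic_on AM U f <-> (forall x, U x -> an_pt f x).
Proof.
move=> oU; split=> [h x Ux c Ac cx|h c x Ac cx Ux].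
  by apply/(analytic_in_chartE _ Ac cx oU Ux); apply: h.
by apply/(analytic_in_chartE _ Ac cx oU Ux); apply: h.
Qed.

Definition trans c d (z : 'rV[K]_(cdim c)) : 'rV[K]_(cdim d) :=
  \row_j @cpull c (fun y => cmap d y 0 j) z.

Lemma transE c d y : AM c -> cdom c y -> @trans c d (cmap c y) = cmap d y.
Proof. by move=> Ac cy; apply/rowP => j; rewrite mxE cpullE. Qed.

Lemma an_pt_coord d x j : AM d -> cdom d x -> an_pt (fun y => cmap d y 0 j) x.
Proof.
move=> Ad dx c Ac cx; apply/(analytic_in_chartE _ Ac cx (mopen_cdom Ad) dx).
exact: (mfd_transition M_manifold Ac Ad cx dx).
Qed.

Lemma trans_analytic c d x j : AM c -> AM d -> cdom c x -> cdom d x ->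
  analytic_at (fun z => @trans c d z 0 j) (cmap c x).
Proof.
move=> Ac Ad cx dx; under eq_fun do rewrite mxE; exact: an_pt_coord.
Qed.

(** One chart suffices: in any other chart [f] is locally [F] composed with the transition map. *)
Lemma an_pt_comp d f x F : AM d -> cdom d x -> analytic_at F (cmap d x) ->
  (exists W, [/\ mopen AM W, W x & forall y, W y -> cdom d y -> f y = F (cmap d y)]) -> an_pt f x.
Proof.
move=> Ad dx aF [W [oW Wx fF]] c Ac cx.
have [r r0 hr] := chart_ball Ac cx (mopenI oW (mopen_cdom Ad)) (conj Wx dx).
have : analytic_at (fun z => F (@trans c d z)) (cmap c x).
  apply: analytic_comp => [j|]; last by rewrite transE.
  exact: trans_analytic.
apply: analytic_local r0 _ => z /hr[y [cy [Wy dy] <-]].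
by rewrite cpullE // transE // fF.
Qed.

Lemma an_pt_local W f g x : mopen AM W -> W x -> (forall y, W y -> f y = g y) -> an_pt f x -> an_pt g x.
Proof.
move=> oW Wx fg hf; have [d Ad dx] := mfd_cover M_manifold x.
apply: (an_pt_comp Ad dx (hf d Ad dx)); exists W; split=> // y Wy dy.
by rewrite cpullE // fg.
Qed.

Lemma an_pt_const k x : an_pt (fun=> k) x.
Proof.
have [d Ad dx] := mfd_cover M_manifold x.
apply: (an_pt_comp Ad dx (analytic_const k _)); exists setT; split=> //; exact: mopenT.
Qed.

Lemma an_ptD f g x : an_pt f x -> an_pt g x -> an_pt (fun y => f y + g y) x.
Proof.
move=> hf hg; have [d Ad dx] := mfd_cover M_manifold x.
apply: (an_pt_comp Ad dx (analyticD (hf d Ad dx) (hg d Ad dx))); exists setT; split=> //.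
  exact: mopenT.
by move=> y _ dy; rewrite !cpullE.
Qed.

Lemma an_ptM f g x : an_pt f x -> an_pt g x -> an_pt (fun y => f y * g y) x.
Proof.
move=> hf hg; have [d Ad dx] := mfd_cover M_manifold x.
apply: (an_pt_comp Ad dx (analyticM (hf d Ad dx) (hg d Ad dx))); exists setT; split=> //.
  exact: mopenT.
by move=> y _ dy; rewrite !cpullE.
Qed.

Lemma mopen_chart d (O : set 'rV[K]_(cdim d)) : AM d -> open_rV O ->
  mopen AM [set y | cdom d y /\ O (cmap d y)].
Proof.
move=> Ad oO c Ac _ [y [cy [dy Oy]] <-].
have [e e0 he] := oO _ Oy.
have [|s s0 hs] := @analytic_continuous p K _ _ (@trans c d) (cmap c y) e e0.
  by move=> j; apply: trans_analytic.
have [r r0 hr] := chart_ball Ac cy (mopen_cdom Ad) dy.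
exists (Num.min r s); first by rewrite lt_min r0.
move=> z hz; have [|y' [cy' dy' e']] := hr z; first by apply: cball_le hz; rewrite ge_min lexx.
exists y' => //; split=> //; split=> //; apply: he.
have := hs z; rewrite transE // -e' transE //; apply.
by rewrite e'; apply: cball_le hz; rewrite ge_min lexx orbT.
Qed.

Definition chball d x (r : rat) : set M := [set y | cdom d y /\ cball (cmap d x) r (cmap d y)].

Lemma mopen_chball d x (r : rat) : AM d -> 0 < r -> mopen AM (chball d x r).
Proof.
move=> Ad r0; apply: mopen_chart => // z hz; exists r => // z' hz'.
exact: cball_trans hz hz'.
Qed.

(** Compact sets of a Hausdorff space are closed. The ultrametric inequality alone would only treat
    points [y] in the domain of the chart; the Hausdorff axiom covers the others. *)
Lemma mclosed_chball (p_prime : prime p) d x (r : rat) : AM d -> 0 < r ->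
  (forall z, cball (cmap d x) r z -> exists2 y, cdom d y & cmap d y = z) ->
  mopen AM (~` chball d x r).
Proof.
move=> Ad r0 im; apply: mopen_local => y nVy.
(* [P S] says that some neighbourhood of [y] avoids the part of the manifold lying over [S]. *)
pose P (S : set 'rV[K]_(cdim d)) :=
  exists W, [/\ mopen AM W, W y & forall u, cdom d u -> S (cmap d u) -> ~ W u].
have [W [oW Wy hW]] : P (cball (cmap d x) r).
  apply: cball_compact => //.
  - by exists setT; split=> //; exact: mopenT.
  - move=> A B [W [oW Wy hW]] [W' [oW' Wy' hW']]; exists (W `&` W'); split=> //; first exact: mopenI.
    by move=> u du [Au|Bu] [Wu Wu']; [apply: (hW u) | apply: (hW' u)].
  - by move=> A B AB [W [oW Wy hW]]; exists W; split=> // u du /AB; apply: hW.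
  - move=> w wx; have [u du uw] := im w wx.
    have uy : u <> y by move=> e; apply: nVy; split; rewrite -e // uw.
    have [U [W [oU oW Uu Wy UW0]]] := mfd_hausdorff M_manifold uy.
    have [e e0 he] := chart_ball Ad du oU Uu; exists e => //; exists W; split=> // v dv.
    rewrite -uw => /he[v' [dv' Uv' /(mfd_inj M_manifold Ad dv' dv) vv]] Wv.
    have UWv : (U `&` W) v by split=> //; rewrite -vv.
    by rewrite UW0 in UWv.
exists W; split=> // u Wu [du hu]; exact: hW du hu Wu.
Qed.

End Manifold.

(** * The Taylor functional of a Weil algebra *)

Section WeilAlgebra.
Variables (K : fieldType) (A : weilAlgebra K).

Lemma wa_scalar_ideal (k : K) : k%:A \in wa_ideal A -> k = 0.
Proof.
move=> h; have : k%:A \in (1 :&: wa_ideal A)%VS by rewrite memv_cap h andbT rpredZ // memv_line.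
rewrite wa_cap0 memv0 scaler_eq0 oner_eq0 orbF => /eqP //.
Qed.

Lemma wa_pr_unique (a : A) (k : K) : a - k%:A \in wa_ideal A -> wa_pr a = k.
Proof.
move=> h; apply/eqP; rewrite -subr_eq0; apply/eqP; apply: wa_scalar_ideal.
have -> : (wa_pr a - k)%:A = (a - k%:A) - (a - (wa_pr a)%:A) by rewrite scalerBl opprB [RHS]addrC subrKA.
by rewrite rpredB // wa_prP.
Qed.

Lemma wa_pr_linear (k : K) (a b : A) : wa_pr (k *: a + b) = k * wa_pr a + wa_pr b.
Proof.
apply: wa_pr_unique; rewrite scalerDl -scalerA opprD addrACA -scalerBr.
by rewrite rpredD ?rpredZ ?wa_prP.
Qed.

Lemma wa_pr_eq0 (a : A) : (wa_pr a == 0) = (a \in wa_ideal A).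
Proof.
apply/eqP/idP => [e|h]; first by have := wa_prP a; rewrite e scale0r subr0.
by apply: wa_pr_unique; rewrite scale0r subr0.
Qed.

Lemma wa_pr_sum (T : Type) (s : seq T) (v : T -> K) (a : T -> A) :
  wa_pr (\sum_(i <- s) v i *: a i) = \sum_(i <- s) v i * wa_pr (a i).
Proof.
elim: s => [|i s ih]; last by rewrite !big_cons wa_pr_linear ih.
by rewrite !big_nil; apply/eqP; rewrite wa_pr_eq0 mem0v.
Qed.

Lemma wa_ord_exists : exists N, (1 < N)%N /\ forall a, a \in wa_ideal A -> a ^+ N = 0.
Proof.
(* The order is raised to at least 2 so that the cube of multi-indices contains those of degree 1,
   that is, the coordinates themselves. *)
have [N hN] := wa_nilp A; exists N.+2; split=> // a ha.
have h m : a ^+ m \in (wa_ideal A ^+ m)%VS.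
  elim: m => [|m ih]; first by rewrite expr0 expv0 memv_line.
  by rewrite exprS expvSl memv_mul.
by have := h N; rewrite hN memv0 !exprSr => /eqP ->; rewrite !mul0r.
Qed.

Definition wa_ord : nat := projT1 (cid wa_ord_exists).

Lemma wa_ord_gt1 : (1 < wa_ord)%N.
Proof. by rewrite /wa_ord; case: cid => N []. Qed.

Lemma wa_ordP (a : A) : a \in wa_ideal A -> a ^+ wa_ord = 0.
Proof. by rewrite /wa_ord; case: cid => N [_ h] /= /h. Qed.

Lemma wa_idealPr (a b : A) : b \in wa_ideal A -> b * a \in wa_ideal A.
Proof. by move=> h; rewrite wa_comm wa_idealP. Qed.

(** The complementary idempotent [1 - a] lies in the nilpotent ideal, and an idempotent equals all
    its positive powers. *)
Lemma wa_idem1 (a : A) : a * a = a -> wa_pr a = 1 -> a = 1.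
Proof.
move=> aa pa; pose u := 1 - a.
have uu : u * u = u by rewrite /u mulrBl mul1r mulrBr mulr1 aa subrr subr0.
have uid : u \in wa_ideal A.
  by rewrite -wa_pr_eq0 /u addrC -scaleN1r wa_pr_linear pa (@wa_pr_unique 1 1) ?scale1r ?subrr ?mem0v // mulN1r addNr.
have uN m : u ^+ m.+1 = u by elim: m => // m ih; rewrite exprS ih uu.
have : u = 0 by have := wa_ordP uid; rewrite -(prednK (ltnW wa_ord_gt1)) uN.
by move/eqP; rewrite /u subr_eq0 eq_sym => /eqP.
Qed.

Variable n : nat.
Implicit Types Y : 'I_n -> A.

Definition amon Y (a : mi n) : A := \prod_k Y k ^+ a k.

(** Commutativity of [A] comes from the axiom [wa_comm] and not from its ring structure, so factors
    are exchanged by induction. *)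
Lemma wa_big_split (T : Type) (s : seq T) (F G : T -> A) :
  \prod_(i <- s) (F i * G i) = (\prod_(i <- s) F i) * \prod_(i <- s) G i.
Proof.
elim: s => [|i s ih]; first by rewrite !big_nil mulr1.
rewrite !big_cons ih -!mulrA; congr (_ * _); rewrite !mulrA; congr (_ * _); exact: wa_comm.
Qed.

Lemma wa_prod_eq0 (T : eqType) (s : seq T) (F : T -> A) i : i \in s -> F i = 0 -> \prod_(i <- s) F i = 0.
Proof.
move=> + e; elim: s => // j s ih; rewrite inE big_cons => /orP[/eqP<-|/ih->]; last by rewrite mulr0.
by rewrite e mul0r.
Qed.

Lemma wa_prod_ideal (T : eqType) (s : seq T) (F : T -> A) i : i \in s -> F i \in wa_ideal A ->
  \prod_(i <- s) F i \in wa_ideal A.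
Proof.
move=> + e; elim: s => // j s ih; rewrite inE big_cons => /orP[/eqP<-|/ih h]; last exact: wa_idealP.
exact: wa_idealPr.
Qed.

Lemma amonD Y a b : amon Y (madd a b) = amon Y a * amon Y b.
Proof. by rewrite /amon -wa_big_split; apply: eq_bigr => k _; rewrite ffunE exprD. Qed.

Lemma amon_m0 Y : amon Y (m0 n) = 1.
Proof. by rewrite /amon big1 // => k _; rewrite ffunE expr0. Qed.

Lemma amon_unit Y k : amon Y (munit k 1) = Y k.
Proof.
rewrite /amon; have : k \in index_enum 'I_n by rewrite mem_index_enum.
have : uniq (index_enum 'I_n) by rewrite index_enum_uniq.
elim: (index_enum 'I_n) => // j s ih /= /andP[js us]; rewrite inE big_cons ffunE => /orP[/eqP kj|ks].
  rewrite -kj eqxx expr1 big_seq big1 ?mulr1 // => i si; rewrite ffunE.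
  by case: eqP => [ik|]; rewrite ?expr0 // -kj -ik si in js.
case: eqP => [jk|_]; last by rewrite expr0 mul1r ih.
by move: js; rewrite jk ks.
Qed.

Lemma amon_big Y (a : mi n) k : (forall k, Y k \in wa_ideal A) -> (wa_ord <= a k)%N -> amon Y a = 0.
Proof.
move=> hY h; apply: (@wa_prod_eq0 _ _ _ k); first by rewrite mem_index_enum.
by rewrite -(subnKC h) exprD wa_ordP ?mul0r.
Qed.

Lemma amon_ideal Y (a : mi n) : (forall k, Y k \in wa_ideal A) -> a != m0 n -> amon Y a \in wa_ideal A.
Proof.
move=> hY a0; have /existsP[k ak] : [exists k, a k != 0%N].
  rewrite -negb_forall; apply: contra a0 => /forallP h.
  by apply/eqP/ffunP => i; rewrite ffunE; apply/eqP.
apply: (@wa_prod_ideal _ _ _ k); first by rewrite mem_index_enum.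
by case: (a k) ak => // m _; rewrite exprS wa_idealPr.
Qed.

End WeilAlgebra.

Section TaylorFunctional.
Variables (p : nat) (K : padicField p) (A : weilAlgebra K).
Hypothesis p_prime : prime p.
Variable n : nat.
Implicit Types (Y : 'I_n -> A) (F G : 'rV[K]_n -> K) (x : 'rV[K]_n).

(** The value of [F] at [x + Y] by Taylor's formula. When every [Y k] is in the ideal, the monomials
    left out by the truncation vanish. *)
Definition tay Y F x : A :=
  \sum_(f : {ffun 'I_n -> 'I_(wa_ord A)}) tcoef F x (mbox f) *: amon Y (mbox f).

Lemma tay_local Y F G x r : 0 < r -> (forall y, cball x r y -> F y = G y) ->
  analytic_at F x -> tay Y F x = tay Y G x.
Proof. by move=> r0 FG aF; rewrite /tay (tcoef_local p_prime r0 FG aF). Qed.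

Lemma sum_box_delta (V : lmodType K) (a : mi n) (v : mi n -> V) : (forall i, (a i < wa_ord A)%N) ->
  \sum_(f : {ffun 'I_n -> 'I_(wa_ord A)}) (if mbox f == a then 1 else 0 : K) *: v (mbox f) = v a.
Proof.
move=> /mboxP[g ag]; rewrite (bigD1 g) //= ag eqxx scale1r big1 ?addr0 // => f fg.
by rewrite (inj_eq (@mbox_inj n _)) (negPf fg) scale0r.
Qed.

Let N0 : (0 < wa_ord A)%N. Proof. exact: ltnW (wa_ord_gt1 A). Qed.

Lemma tay_const Y k x : tay Y (fun=> k) x = k%:A.
Proof.
rewrite /tay tcoef_const //.
have h := @sum_box_delta A (m0 n) (amon Y); rewrite amon_m0 in h.
rewrite -h ?scaler_sumr => [|i]; last by rewrite ffunE.
by apply: eq_bigr => f _; rewrite scalerA; case: eqP; rewrite ?mulr1 ?mulr0.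
Qed.

Lemma tay_coord Y k x : tay Y (fun y => y 0 k) x = (x 0 k)%:A + Y k.
Proof.
rewrite /tay tcoef_coord //.
have h0 := @sum_box_delta A (m0 n) (amon Y); rewrite amon_m0 in h0.
have h1 := @sum_box_delta A (munit k 1) (amon Y); rewrite amon_unit in h1.
rewrite -h0 => [|i]; last by rewrite ffunE.
rewrite -h1 => [|i]; last by rewrite ffunE; case: ifP => // _; exact: wa_ord_gt1.
rewrite scaler_sumr -big_split /=; apply: eq_bigr => f _.
by rewrite scalerA -scalerDl; case: (mbox f == m0 n); rewrite ?mulr1 ?mulr0.
Qed.

Lemma tayD Y F G x : analytic_at F x -> analytic_at G x ->
  tay Y (fun y => F y + G y) x = tay Y F x + tay Y G x.
Proof.
move=> aF aG; rewrite /tay tcoefD // -big_split; by apply: eq_bigr => f _; rewrite scalerDl.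
Qed.

Lemma tayZ Y k F x : analytic_at F x -> tay Y (fun y => k * F y) x = k *: tay Y F x.
Proof.
move=> aF; rewrite /tay tcoefZ // scaler_sumr; by apply: eq_bigr => f _; rewrite scalerA.
Qed.

(** Truncation respects products: when the product of two monomials leaves the cube it contains the
    [wa_ord A]-th power of some [Y k], which is 0. *)
Lemma tayM Y F G x : (forall k, Y k \in wa_ideal A) -> analytic_at F x -> analytic_at G x ->
  tay Y (fun y => F y * G y) x = tay Y F x * tay Y G x.
Proof.
move=> hY aF aG; rewrite /tay mulr_suml.
under [RHS]eq_bigr do rewrite mulr_sumr.
under [LHS]eq_bigr => f _ do rewrite (tcoefM p_prime f aF aG) scaler_suml.
rewrite exchange_big; apply: eq_bigr => g _ /=.
under [LHS]eq_bigr do rewrite scaler_suml.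
rewrite exchange_big; apply: eq_bigr => h _ /=.
rewrite -scalerAl -scalerAr scalerA -amonD.
set a := madd _ _; set k := _ * _.
have -> : \sum_(f : {ffun 'I_n -> 'I_(wa_ord A)}) (if a == mbox f then k else 0) *: amon Y (mbox f) =
   k *: \sum_(f : {ffun 'I_n -> 'I_(wa_ord A)}) (if mbox f == a then 1 else 0 : K) *: amon Y (mbox f).
  rewrite scaler_sumr; apply: eq_bigr => f _; rewrite scalerA eq_sym.
  by case: eqP; rewrite ?mulr1 ?mulr0.
congr (_ *: _).
case: (boolP [forall i, (a i < wa_ord A)%N]) => [/forallP|]; first exact: sum_box_delta.
rewrite negb_forall => /existsP[i]; rewrite -leqNgt => hi.
rewrite (amon_big hY hi) big1 // => f _; case: eqP => [e|_]; last by rewrite scale0r.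
by move: hi; rewrite -e ffunE leqNgt ltn_ord.
Qed.

Lemma tcoef_m0 F x : analytic_at F x -> tcoef F x (m0 n) = F x.
Proof. by move=> /(tcoef_expands p_prime)[r r0 h]; rewrite (expands_center (ltW r0) h). Qed.

Lemma tay_pr Y F x : (forall k, Y k \in wa_ideal A) -> analytic_at F x -> wa_pr (tay Y F x) = F x.
Proof.
move=> hY aF; apply: wa_pr_unique.
have [|g gE] := @mboxP n (wa_ord A) (m0 n); first by move=> i; rewrite ffunE.
rewrite /tay (bigD1 g) //= -gE amon_m0 tcoef_m0 // addrAC subrr add0r.
apply: rpred_sum => f fg; rewrite rpredZ // amon_ideal // gE (inj_eq (@mbox_inj n _)) //.
Qed.

End TaylorFunctional.

(** * Taylor form of infinitely near points *)

Section NearPoints.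
Local Open Scope classical_set_scope.
Variables (p : nat) (K : padicField p) (M : Type) (AM : atlas K M).
Hypothesis p_prime : prime p.
Hypothesis M_manifold : is_manifold AM.
Variable A : weilAlgebra K.
Local Notation nu := (@Qp_abs p K).
Local Notation near_point := (near_point AM A).
Implicit Types (c d : chart K M) (x y : M) (U V W : set M) (f g : M -> K) (xi zeta : near_point).

(** For clopen [V] this extension by zero turns a function analytic on [V] only into an argument for
    every near point. *)
Definition ind V f : M -> K := fun y => if pselect (V y) then f y else 0.

Lemma ind_in V f y : V y -> ind V f y = f y.
Proof. by rewrite /ind; case: pselect. Qed.

Lemma ind_out V f y : ~ V y -> ind V f y = 0.
Proof. by rewrite /ind; case: pselect. Qed.

Lemma an_pt_ind V f : mopen AM V -> mopen AM (~` V) -> (forall y, V y -> an_pt AM f y) ->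
  forall y, an_pt AM (ind V f) y.
Proof.
move=> oV oC hf y; case: (pselect (V y)) => Vy.
  by apply: (an_pt_local M_manifold oV Vy) (hf y Vy) => z Vz; rewrite ind_in.
apply: (@an_pt_local _ _ _ _ M_manifold (~` V) (fun=> 0) _ y oC Vy); last exact: an_pt_const.
by move=> z nVz; rewrite ind_out.
Qed.

Section Hom.
Variable xi : near_point.
Let x := np_base xi.
Let U := np_dom xi.
Let ax : is_near_point AM x U (np_hom xi) := np_axiom xi.

Definition adm f := forall y, U y -> an_pt AM f y.

Lemma admP f : adm f <-> analytic_on AM U f.
Proof. by split=> [h|h]; apply/(analytic_onE M_manifold _ (np_open ax)). Qed.

Lemma adm_all f : (forall y, an_pt AM f y) -> adm f.
Proof. by move=> h y _. Qed.

Lemma adm_const k : adm (fun=> k).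
Proof. by move=> y _; exact: an_pt_const. Qed.
Lemma admD f g : adm f -> adm g -> adm (fun y => f y + g y).
Proof. by move=> hf hg y Uy; apply: an_ptD => //; [exact: hf | exact: hg]. Qed.
Lemma admM f g : adm f -> adm g -> adm (fun y => f y * g y).
Proof. by move=> hf hg y Uy; apply: an_ptM => //; [exact: hf | exact: hg]. Qed.

Lemma homD f g : adm f -> adm g -> np_hom xi (fun y => f y + g y) = np_hom xi f + np_hom xi g.
Proof. by move=> /admP hf /admP hg; apply: (np_add ax). Qed.
Lemma homM f g : adm f -> adm g -> np_hom xi (fun y => f y * g y) = np_hom xi f * np_hom xi g.
Proof. by move=> /admP hf /admP hg; apply: (np_mul ax). Qed.
Lemma homZ k f : adm f -> np_hom xi (fun y => k * f y) = k *: np_hom xi f.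
Proof. by move=> /admP hf; apply: (np_scale ax). Qed.
Lemma hom1 : np_hom xi (fun=> 1) = 1. Proof. exact: (np_one ax). Qed.
Lemma hom_const k : np_hom xi (fun=> k) = k%:A.
Proof.
by rewrite -hom1 -homZ; [congr np_hom; apply/funext => y; rewrite mulr1 | exact: adm_const].
Qed.
Lemma hom_ev f : adm f -> wa_pr (np_hom xi f) = f x.
Proof. by move=> /admP; exact: (np_ev ax). Qed.
Lemma hom_sum (T : Type) (s : seq T) (F : T -> M -> K) : (forall i, adm (F i)) ->
  adm (fun y => \sum_(i <- s) F i y) /\
  np_hom xi (fun y => \sum_(i <- s) F i y) = \sum_(i <- s) np_hom xi (F i).
Proof.
move=> hF; elim: s => [|i s [a e]].
  have -> : (fun y => \sum_(i <- [::]) F i y) = fun=> 0 by apply/funext => y; rewrite big_nil.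
  by rewrite big_nil hom_const scale0r; split=> //; exact: adm_const.
have -> : (fun y => \sum_(j <- i :: s) F j y) = fun y => F i y + \sum_(j <- s) F j y.
  by apply/funext => y; rewrite big_cons.
by rewrite homD // e big_cons; split=> //; exact: admD.
Qed.

Lemma hom_exp f m : adm f -> adm (fun y => f y ^+ m) /\ np_hom xi (fun y => f y ^+ m) = np_hom xi f ^+ m.
Proof.
move=> hf; elim: m => [|m [a e]]; first by split; [exact: adm_const | exact: hom1].
have -> : (fun y => f y ^+ m.+1) = fun y => f y * f y ^+ m by apply/funext => y; rewrite exprS.
by rewrite homM // e exprS; split=> //; exact: admM.
Qed.

Lemma hom_prod (T : Type) (s : seq T) (F : T -> M -> K) : (forall i, adm (F i)) ->
  adm (fun y => \prod_(i <- s) F i y) /\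
  np_hom xi (fun y => \prod_(i <- s) F i y) = \prod_(i <- s) np_hom xi (F i).
Proof.
move=> hF; elim: s => [|i s [a e]].
  have -> : (fun y => \prod_(i <- [::]) F i y) = fun=> 1 by apply/funext => y; rewrite big_nil.
  by rewrite big_nil hom1; split=> //; exact: adm_const.
have -> : (fun y => \prod_(j <- i :: s) F j y) = fun y => F i y * \prod_(j <- s) F j y.
  by apply/funext => y; rewrite big_cons.
by rewrite homM // e big_cons; split=> //; exact: admM.
Qed.

(* The value on an indicator of a clopen neighbourhood is an idempotent
   congruent to 1 modulo the ideal. *)
Lemma hom_ind1 V : mopen AM V -> mopen AM (~` V) -> V x -> np_hom xi (ind V (fun=> 1)) = 1.
Proof.
move=> oV oC Vx; have a : adm (ind V (fun=> 1)).
  by apply: adm_all; apply: an_pt_ind => // y _; exact: an_pt_const.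
apply: wa_idem1; last by rewrite hom_ev // ind_in.
rewrite -homM //; congr np_hom; apply/funext => y.
by case: (pselect (V y)) => Vy; [rewrite ind_in // mulr1 | rewrite ind_out // mulr0].
Qed.

End Hom.

(** [np_dom xi] need not lie in the chart [d]: the right-hand side only uses the germ of [f] at the
    base point. *)
Definition np_taylor d xi (Y : 'I_(cdim d) -> A) :=
  forall f, analytic_on AM (np_dom xi) f ->
    np_hom xi f = tay Y (@cpull _ _ _ d f) (cmap d (np_base xi)).

Definition shift_coord d x k : M -> K := fun y => cmap d y 0 k - cmap d x 0 k.

Arguments shift_coord d x k : clear implicits.
Arguments np_taylor d xi Y : clear implicits.

Lemma an_pt_shift d x k y : AM d -> cdom d y -> an_pt AM (shift_coord d x k) y.
Proof.
move=> Ad dy; apply: (an_ptD M_manifold); first exact: an_pt_coord.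
exact: an_pt_const.
Qed.

(** All radii up to [r0] are kept because the expansion of a given [f] may hold only on a smaller
    ball. *)
Lemma np_ball d xi : AM d -> cdom d (np_base xi) ->
  exists r0, [/\ 0 < r0,
    forall r, 0 < r -> r <= r0 -> chball d (np_base xi) r `<=` np_dom xi &
    forall r, 0 < r -> r <= r0 -> mopen AM (~` chball d (np_base xi) r)].
Proof.
move=> Ad dx; have [r0 r00 hr] := chart_ball Ad dx (np_open (np_axiom xi)) (np_mem (np_axiom xi)).
exists r0; split=> //.
  move=> r rp rr y [dy /(cball_le rr)/hr[y' [dy' Uy' e]]].
  by rewrite -(mfd_inj M_manifold Ad dy' dy e).
move=> r rp rr; apply: mclosed_chball => // z /(cball_le rr)/hr[y [dy _ <-]].
by exists y.
Qed.

(** The centred coordinates extended by zero are in the domain of [np_hom xi] and recover [Y];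
    uniqueness of [Y] follows. *)
Lemma np_taylor_shift d xi Y V k : AM d -> cdom d (np_base xi) -> np_taylor d xi Y ->
  mopen AM V -> mopen AM (~` V) -> V (np_base xi) -> V `<=` cdom d ->
  np_hom xi (ind V (shift_coord d (np_base xi) k)) = Y k.
Proof.
set x := np_base xi => Ad dx hY oV oC Vx Vd.
have a : forall y, an_pt AM (ind V (shift_coord d x k)) y.
  by apply: an_pt_ind => // y Vy; apply: an_pt_shift => //; exact: Vd.
rewrite hY; last by apply/admP; exact: adm_all.
have [r r0 hr] := chart_ball Ad dx oV Vx.
rewrite -/x (@tay_local _ _ _ p_prime _ _ _ (fun z => z 0 k + - cmap d x 0 k) _ r r0).
- rewrite tayD //; [|exact: analytic_coord|exact: analytic_const].
  by rewrite tay_coord // tay_const // scaleNr addrAC subrr add0r.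
- by move=> z /hr[y [dy Vy <-]]; rewrite (cpullE M_manifold) // ind_in.
- exact: a.
Qed.

Lemma np_taylor_exists d xi : AM d -> cdom d (np_base xi) ->
  exists Y, (forall k, Y k \in wa_ideal A) /\ np_taylor d xi Y.
Proof.
move=> Ad dx; have [r0 [r00 hsub hcl]] := np_ball Ad dx.
set x := np_base xi in dx hsub hcl *.
pose V r := chball d x r.
have oV r : 0 < r -> mopen AM (V r) by move=> rp; exact: mopen_chball.
have Vx r : 0 < r -> V r x by move=> rp; split=> //; apply: cball_center; exact: ltW.
(* The coordinates are cut off at the fixed radius [r0] because [Y] must not depend on [f]; only the
   radius [r] below shrinks with [f]. *)
pose q k := ind (V r0) (shift_coord d x k).
have aq k : forall y, an_pt AM (q k) y.
  apply: an_pt_ind => [||y [dy _]]; [exact: oV | exact: hcl | exact: an_pt_shift].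
pose Y k := np_hom xi (q k).
have hY k : Y k \in wa_ideal A.
  have qx : q k x = 0 by rewrite /q ind_in /shift_coord ?subrr //; exact: Vx.
  by rewrite -wa_pr_eq0 /Y hom_ev; [rewrite -/x qx | exact: adm_all].
exists Y; split=> // f /admP af.
have afx : analytic_at (@cpull _ _ _ d f) (cmap d x) by apply: af => //; exact: (np_mem (np_axiom xi)).
have [s s0 hs] := tcoef_expands p_prime afx.
pose r := Num.min r0 s; have rp : 0 < r by rewrite lt_min r00.
have rr0 : r <= r0 by rewrite ge_min lexx.
have rs : r <= s by rewrite ge_min lexx orbT.
have [g [hg hF]] := expands_hadamard (wa_ord A) rp (expandsW rp rs hs).
pose e := ind (V r) (fun=> 1).
have ae : forall y, an_pt AM e y.
  by apply: an_pt_ind => [||y _]; [exact: oV | exact: hcl | exact: an_pt_const].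
pose G k := ind (V r) (fun y => g k (cmap d y)).
have aG k : forall y, an_pt AM (G k) y.
  apply: an_pt_ind => [||y [dy yr]]; [exact: oV | exact: hcl | ].
  have [dd hdd] := hg k.
  apply: (an_pt_comp M_manifold Ad dy (expands_analytic rp hdd yr)).
  by exists setT; split=> //; exact: (mopenT M_manifold).
have he : np_hom xi e = 1 by apply: hom_ind1; [exact: oV | exact: hcl | exact: Vx].
pose B (h : {ffun 'I_(cdim d) -> 'I_(wa_ord A)}) y :=
  tcoef (@cpull _ _ _ d f) (cmap d x) (mbox h) * \prod_k q k y ^+ (mbox h k) * e y.
(* The indicator [e] turns the expansion on the small ball into an identity on all of [M]. It is
   sent to 1, so the left side has the same value as [f]; the second sum is sent to 0 since
   [Y k ^+ wa_ord A = 0]. *)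
have fE y : f y * e y = \sum_h B h y + \sum_k q k y ^+ wa_ord A * G k y.
  case: (pselect (V r y)) => Vy; last first.
    rewrite /e ind_out // mulr0 !big1 ?addr0 // => [k _|h _]; rewrite /B /e /G ind_out ?mulr0 //.
  have [dy yr] := Vy; have Vy0 : V r0 y by split=> //; apply: cball_le yr.
  have := hF _ yr; rewrite (cpullE M_manifold) // => ->; rewrite /e ind_in // mulr1.
  congr (_ + _); last by apply: eq_bigr => k _; rewrite /q /G !ind_in.
  apply: eq_bigr => h _.
  rewrite /B /e ind_in // mulr1; congr (_ * _); rewrite /monom; apply: eq_bigr => k _.
  by rewrite /q ind_in // /shift_coord !mxE.
have aB h : adm xi (B h) /\ np_hom xi (B h) = tcoef (@cpull _ _ _ d f) (cmap d x) (mbox h) *: amon Y (mbox h).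
  have [a1 e1] := @hom_prod xi _ (index_enum _) (fun k y => q k y ^+ mbox h k)
    (fun k => (hom_exp (mbox h k) (adm_all (aq k))).1).
  rewrite /B; under eq_fun do rewrite -mulrA.
  have a2 : adm xi (fun y => (\prod_k q k y ^+ mbox h k) * e y) by apply: admM => //; exact: adm_all.
  split; first by apply: admM => //; exact: adm_const.
  rewrite (homZ _ a2) (homM a1 (adm_all ae)) he mulr1 e1; congr (_ *: _); apply: eq_bigr => k _.
  by rewrite (hom_exp (mbox h k) (adm_all (aq k))).2.
have aQ k : adm xi (fun y => q k y ^+ wa_ord A * G k y) /\ np_hom xi (fun y => q k y ^+ wa_ord A * G k y) = 0.
  have [a1 e1] := @hom_exp xi (q k) (wa_ord A) (adm_all (aq k)).
  split; first by apply: admM => //; exact: adm_all.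
  by rewrite (homM a1 (adm_all (aG k))) e1 (wa_ordP (hY k)) mul0r.
have -> : np_hom xi f = np_hom xi (fun y => f y * e y).
  by rewrite (homM af (adm_all ae)) he mulr1.
have -> : (fun y => f y * e y) = fun y => \sum_h B h y + \sum_k q k y ^+ wa_ord A * G k y.
  exact/funext.
have [a1 e1] := @hom_sum xi _ (index_enum _) B (fun h => (aB h).1).
have [a2 e2] := @hom_sum xi _ (index_enum _) (fun k y => q k y ^+ wa_ord A * G k y) (fun k => (aQ k).1).
rewrite homD // e1 e2 [X in _ + X]big1 ?addr0 => [|k _]; last exact: (aQ k).2.
by apply: eq_bigr => h _; exact: (aB h).2.
Qed.

Lemma np_taylor_unique d xi Y Y' : AM d -> cdom d (np_base xi) ->
  np_taylor d xi Y -> np_taylor d xi Y' -> Y = Y'.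
Proof.
move=> Ad dx hY hY'; have [r0 [r00 _ hcl]] := np_ball Ad dx.
have oV := @mopen_chball _ _ _ _ M_manifold d (np_base xi) r0 Ad r00.
have Vx : chball d (np_base xi) r0 (np_base xi) by split=> //; apply: cball_center; exact: ltW.
have Vd : chball d (np_base xi) r0 `<=` cdom d by move=> y [].
apply/funext => k.
rewrite -(np_taylor_shift k Ad dx hY oV (hcl _ r00 (lexx _)) Vx Vd).
exact: (np_taylor_shift k Ad dx hY' oV (hcl _ r00 (lexx _)) Vx Vd).
Qed.

Lemma np_of_axiom d x U (Y : 'I_(cdim d) -> A) : AM d -> cdom d x -> mopen AM U -> U x ->
  (forall k, Y k \in wa_ideal A) ->
  is_near_point AM x U (fun f => tay Y (@cpull _ _ _ d f) (cmap d x)).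
Proof.
move=> Ad dx oU Ux hY.
have an f : analytic_on AM U f -> analytic_at (@cpull _ _ _ d f) (cmap d x).
  by move=> /(analytic_onE M_manifold _ oU) h; apply: h.
have [r r0 hr] := chart_ball Ad dx oU Ux.
split=> //.
- move=> f g af ag fg; apply: (tay_local p_prime _ r0) (an f af) => z /hr[y [dy Uy <-]].
  by rewrite !(cpullE M_manifold) // fg.
- rewrite -[RHS]scale1r -(tay_const p_prime Y 1 (cmap d x)).
  apply: esym; apply: (tay_local p_prime _ r0); last exact: analytic_const.
  by move=> z /hr[y [dy Uy <-]]; rewrite (cpullE M_manifold).
- move=> f g af ag; rewrite -tayD //; [|exact: an..].
  apply: esym; apply: (tay_local p_prime _ r0); last by apply: analyticD; exact: an.
  by move=> z /hr[y [dy Uy <-]]; rewrite !(cpullE M_manifold).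
- move=> k f af; rewrite -tayZ //; last exact: an.
  apply: esym; apply: (tay_local p_prime _ r0).
    by move=> z /hr[y [dy Uy <-]]; rewrite !(cpullE M_manifold).
  by apply: analyticM; [exact: analytic_const | exact: an].
- move=> f g af ag; rewrite -tayM //; [|exact: an..].
  apply: esym; apply: (tay_local p_prime _ r0); last by apply: analyticM; exact: an.
  by move=> z /hr[y [dy Uy <-]]; rewrite !(cpullE M_manifold).
- by move=> f af; rewrite tay_pr ?(cpullE M_manifold) //; exact: an.
Qed.

Definition np_of d x U (Y : 'I_(cdim d) -> A) (Ad : AM d) (dx : cdom d x) (oU : mopen AM U) (Ux : U x)
  (hY : forall k, Y k \in wa_ideal A) : near_point := NearPoint (np_of_axiom Ad dx oU Ux hY).

Lemma np_taylor_sub d xi zeta Y : np_induced xi zeta -> np_taylor d zeta Y -> np_taylor d xi Y.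
Proof.
move=> [eb sub h] hY f af; rewrite h // hY ?eb //.
by move=> c x Ac cx Zx; have [F h1 h2] := af c x Ac cx (sub x Zx); exists F => // y cy Zy; apply: h1 => //; apply: sub.
Qed.

(** Passing from [xi] to [zeta] is not formal, since functions on the smaller domain need not
    extend. A tuple for [zeta] exists, restricts to [xi], and is [Y] by uniqueness there. *)
Lemma np_taylor_induced d xi zeta Y : AM d -> cdom d (np_base xi) -> np_induced xi zeta ->
  np_taylor d xi Y <-> np_taylor d zeta Y.
Proof.
move=> Ad dx iz; split; last exact: np_taylor_sub.
have dz : cdom d (np_base zeta) by case: iz => <-.
have [Y' [_ hY']] := np_taylor_exists Ad dz.
by move=> hY; rewrite (np_taylor_unique Ad dx hY (np_taylor_sub iz hY')).
Qed.

Lemma np_taylor_equiv d xi zeta Y : AM d -> cdom d (np_base xi) -> np_equiv xi zeta ->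
  np_taylor d xi Y <-> np_taylor d zeta Y.
Proof.
move=> Ad + e; elim: e => [x y h dx|x dx|x y h ih dy|x y z hxy ihxy hyz ihyz dx].
- exact: np_taylor_induced.
- by [].
- by apply: iff_sym; apply: ih; rewrite (np_equiv_base h).
- by apply: iff_trans (ihxy dx) _; apply: ihyz; rewrite -(np_equiv_base hxy).
Qed.

(** Both points are induced by the Taylor functional on the intersection of their domains. *)
Lemma np_taylor_eq d xi zeta Y : AM d -> cdom d (np_base xi) -> np_base xi = np_base zeta ->
  (forall k, Y k \in wa_ideal A) -> np_taylor d xi Y -> np_taylor d zeta Y -> np_equiv xi zeta.
Proof.
move=> Ad dx eb hY hx hz.
have oI := mopenI M_manifold (np_open (np_axiom xi)) (np_open (np_axiom zeta)).
have Ix : (np_dom xi `&` np_dom zeta) (np_base xi).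
  by split; [exact: (np_mem (np_axiom xi)) | rewrite eb; exact: (np_mem (np_axiom zeta))].
pose th := np_of Ad dx oI Ix hY.
apply: (rst_trans _ _ _ th).
  by apply: rst_step; split; [by [] | by move=> y [] | exact: hx].
apply: rst_sym; apply: rst_step; split; [by rewrite -eb | by move=> y [] | ].
by move=> f af; rewrite hz // -eb.
Qed.

End NearPoints.

Arguments np_taylor {p K M AM A} d xi Y.

(** * Coordinates on the Weil bundle *)

Section WeilBundleCoordinates.
Local Open Scope classical_set_scope.
Variables (p : nat) (K : padicField p) (M : Type) (AM : atlas K M).
Hypothesis p_prime : prime p.
Hypothesis M_manifold : is_manifold AM.
Variable A : weilAlgebra K.
Local Notation l := (\dim (fullv : {vspace A})).
Variable alpha : l.-tuple A.
Hypothesis alpha_basis : basis_of fullv alpha.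
Local Notation near_point := (near_point AM A).
Local Notation weil_bundle := (weil_bundle AM A).
Implicit Types (c d : chart K M) (x y : M) (xi zeta : near_point) (X : weil_bundle).

Lemma wb_eq X X' xi : wb_class X xi -> wb_class X' xi -> X = X'.
Proof.
case: X X' => C [z Cz] [C' [z' Cz']] /=; move: Cz Cz' (ex_intro _ z Cz) (ex_intro _ z' Cz') => -> -> P P' h h'.
have e : [set zeta | np_equiv z zeta] = [set zeta | np_equiv z' zeta].
  apply/seteqP; split=> t /= ht.
    by apply: rst_trans h' _; apply: rst_trans ht; apply: rst_sym.
  by apply: rst_trans h _; apply: rst_trans ht; apply: rst_sym.
by move: P P'; rewrite e => P P'; congr WeilBundle; exact: Prop_irrelevance.
Qed.

Lemma wb_class_equiv X xi zeta : wb_class X xi -> wb_class X zeta -> np_equiv xi zeta.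
Proof.
by case: X => C [z Cz] /=; rewrite Cz /= => h h'; apply: rst_trans h'; apply: rst_sym.
Qed.

Lemma wb_class_closed X xi zeta : wb_class X xi -> np_equiv xi zeta -> wb_class X zeta.
Proof. by case: X => C [z Cz] /=; rewrite Cz /= => h h'; apply: rst_trans h h'. Qed.

(** The same choice as in [wb_proj], so that [np_base (wb_rep X)] is [wb_proj X] by conversion. *)
Definition wb_rep X : near_point := projT1 (cid (wb_classP X)).

Lemma wb_repP X : wb_class X (wb_rep X).
Proof. by rewrite /wb_rep; case: cid => z /= ->; exact: rst_refl. Qed.

Lemma wb_of_class xi : wb_class (wb_of xi) xi.
Proof. exact: rst_refl. Qed.

(* A matrix v of Weil coordinates encodes the elements vA v k of A, which
   split into the base point vpr v and the nilpotent part vY v. *)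
Definition vA n (v : 'M[K]_(n, l)) (k : 'I_n) : A := \sum_j v k j *: tnth alpha j.
Definition vpr n (v : 'M[K]_(n, l)) : 'rV[K]_n := \row_k wa_pr (vA v k).
Definition vY n (v : 'M[K]_(n, l)) (k : 'I_n) : A := vA v k - (wa_pr (vA v k))%:A.

Lemma vY_ideal n (v : 'M[K]_(n, l)) k : vY v k \in wa_ideal A.
Proof. exact: wa_prP. Qed.

Lemma coord_vA n (v : 'M[K]_(n, l)) k j : coord alpha j (vA v k) = v k j.
Proof.
rewrite /vA; under eq_bigr do rewrite (tnth_nth 0).
by rewrite coord_sum_free // (basis_free alpha_basis).
Qed.

Lemma sum_coord (a : A) : a = \sum_j coord alpha j a *: tnth alpha j.
Proof.
under eq_bigr do rewrite (tnth_nth 0).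
by apply: coord_basis alpha_basis _; rewrite memvf.
Qed.

Lemma vA_inj n (v w : 'M[K]_(n, l)) : vA v =1 vA w -> v = w.
Proof. by move=> h; apply/matrixP => k j; rewrite -!coord_vA h. Qed.

Lemma tay_cpull_coord d x (Y : 'I_(cdim d) -> A) k : AM d -> cdom d x ->
  tay Y (@cpull _ _ _ d (fun y => cmap d y 0 k)) (cmap d x) = (cmap d x 0 k)%:A + Y k.
Proof.
move=> Ad dx; rewrite -tay_coord //; apply: esym.
have [r r0 hr] := chart_ball Ad dx (mopen_cdom M_manifold Ad) dx.
apply: (tay_local p_prime _ r0); last exact: analytic_coord.
by move=> z /hr[y [dy _ <-]]; rewrite (cpullE M_manifold).
Qed.

Lemma coord_on d U k : AM d -> U `<=` cdom d -> mopen AM U -> analytic_on AM U (fun y => cmap d y 0 k).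
Proof.
move=> Ad Ud oU; apply/(analytic_onE M_manifold _ oU) => x Ux; apply: an_pt_coord => //; exact: Ud.
Qed.

Lemma wb_coordP d X : AM d -> cdom d (wb_proj X) ->
  cmap d (wb_proj X) = vpr (wb_coord AM alpha d X) /\
  forall xi, wb_class X xi -> np_taylor d xi (vY (wb_coord AM alpha d X)).
Proof.
move=> Ad dx; set v := wb_coord _ _ _ _.
have dx' : cdom d (np_base (wb_rep X)) by [].
have [Y [hY hT]] := np_taylor_exists p_prime M_manifold Ad dx'.
have all xi : wb_class X xi -> np_taylor d xi Y.
  move=> h; have e := wb_class_equiv (wb_repP X) h.
  exact: (proj1 (np_taylor_equiv p_prime M_manifold Y Ad dx' e)).
have [xi [Xxi sub hv]] : exists xi, [/\ wb_class X xi, np_dom xi `<=` cdom d &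
    forall k, np_hom xi (fun y => cmap d y 0 k) = \sum_j v k j *: tnth alpha j].
  pose P := [set v : 'M[K]_(cdim d, l) | exists xi, [/\ wb_class X xi, np_dom xi `<=` cdom d &
    forall k, np_hom xi (fun y => cmap d y 0 k) = \sum_j v k j *: tnth alpha j]].
  (* The set from which [wb_coord] chooses is inhabited: restrict the Taylor functional of [X] to
     the part of its domain inside the chart. *)
  suff : exists w, P w by move/(xgetPex 0).
  have oI := mopenI M_manifold (np_open (np_axiom (wb_rep X))) (mopen_cdom M_manifold Ad).
  have Ix : (np_dom (wb_rep X) `&` cdom d) (np_base (wb_rep X)).
    by split=> //; exact: (np_mem (np_axiom (wb_rep X))).
  pose z := np_of p_prime M_manifold Ad dx' oI Ix hY.
  exists (\matrix_(k, j) coord alpha j ((cmap d (np_base z) 0 k)%:A + Y k)), z; split=> [|y []|k] //.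
    apply: wb_class_closed (wb_repP X) _; apply: rst_step.
    by split; [by [] | by move=> y [] | exact: hT].
  rewrite /= tay_cpull_coord // [LHS]sum_coord; apply: eq_bigr => j _; by rewrite mxE.
have hA k : vA v k = (cmap d (wb_proj X) 0 k)%:A + Y k.
  rewrite /vA -hv (all xi Xxi).
    rewrite (wb_projE Xxi) tay_cpull_coord //; by rewrite -(wb_projE Xxi).
  by apply: coord_on => //; exact: (np_open (np_axiom xi)).
have hpr k : wa_pr (vA v k) = cmap d (wb_proj X) 0 k.
  by apply: wa_pr_unique; rewrite hA addrAC subrr add0r.
split; first by apply/rowP => k; rewrite mxE hpr.
have -> : vY v = Y by apply/funext => k; rewrite /vY hpr hA addrAC subrr add0r.
exact: all.
Qed.

Lemma wb_coord_inj d X X' : AM d -> cdom d (wb_proj X) -> cdom d (wb_proj X') ->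
  wb_coord AM alpha d X = wb_coord AM alpha d X' -> X = X'.
Proof.
move=> Ad dx dx' e; have [e1 t1] := wb_coordP Ad dx; have [e2 t2] := wb_coordP Ad dx'.
have ex : wb_proj X = wb_proj X' by apply: (mfd_inj M_manifold Ad dx dx'); rewrite e1 e2 e.
have h : np_equiv (wb_rep X) (wb_rep X').
  apply: (np_taylor_eq p_prime M_manifold Ad dx ex (vY_ideal (wb_coord AM alpha d X))).
    exact: t1 (wb_repP X).
  rewrite e; exact: t2 (wb_repP X').
exact: wb_eq (wb_class_closed (wb_repP X) h) (wb_repP X').
Qed.

Lemma wb_coord_surj d x (v : 'M[K]_(cdim d, l)) : AM d -> cdom d x -> cmap d x = vpr v ->
  exists X, wb_proj X = x /\ wb_coord AM alpha d X = v.
Proof.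
move=> Ad dx e.
(* The domain can be all of [M], as the Taylor functional reads only germs at [x]. *)
pose z := np_of p_prime M_manifold Ad dx (mopenT M_manifold) (I : setT x) (vY_ideal v).
exists (wb_of z); have pz : wb_proj (wb_of z) = x by rewrite wb_proj_of.
split=> //; have dz : cdom d (wb_proj (wb_of z)) by rewrite pz.
have [e1 t1] := wb_coordP Ad dz.
have tz : np_taylor d z (vY v) by [].
have dz' : cdom d (np_base z) by [].
have hY := np_taylor_unique p_prime M_manifold Ad dz' (t1 z (wb_of_class z)) tz.
apply: vA_inj => k; have /(congr1 (@^~ k)) := hY; rewrite /vY /= => h.
move/rowP: e1 => /(_ k); move/rowP: e => /(_ k); rewrite pz !mxE => -> e1.
by move: h; rewrite e1 => /addIr.
Qed.

(** Gives a representative on any prescribed neighbourhood [U] of the base point. *)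
Lemma np_of_in d X U (Ad : AM d) (dx : cdom d (wb_proj X)) (oU : mopen AM U) (Ux : U (wb_proj X)) :
  wb_class X (np_of p_prime M_manifold Ad dx oU Ux (vY_ideal (wb_coord AM alpha d X))).
Proof.
have [e1 t1] := wb_coordP Ad dx; apply: wb_class_closed (wb_repP X) _.
apply: (np_taylor_eq p_prime M_manifold Ad dx) => //; first exact: (vY_ideal (wb_coord AM alpha d X)).
exact: t1 (wb_repP X).
Qed.

End WeilBundleCoordinates.

(** * The lifted action *)

Section Lift.
Local Open Scope classical_set_scope.
Variables (p : nat) (K : padicField p) (M : Type) (AM : atlas K M).
Hypothesis p_prime : prime p.
Hypothesis M_manifold : is_manifold AM.
Variable A : weilAlgebra K.
Variables (G : groupType) (AG : atlas K G).
Hypothesis G_manifold : is_manifold AG.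
Variable act : G -> M -> M.
Hypothesis act_action : is_analytic_action AG AM act.
Local Notation near_point := (near_point AM A).
Local Notation weil_bundle := (weil_bundle AM A).
Implicit Types (cg : chart K G) (c d e : chart K M) (x y : M) (g h : G)
  (xi zeta : near_point) (X : weil_bundle) (U W : set M) (f : M -> K).

Let act1 := act_1 act_action.
Let actM := act_M act_action.

Lemma actK g : cancel (act g) (act g^-1%g).
Proof. by move=> x; rewrite -actM mulVg act1. Qed.

Lemma actVK g : cancel (act g^-1%g) (act g).
Proof. by move=> x; rewrite -actM mulgV act1. Qed.

(** Continuity in the product chart yields some pair with the given coordinates that is mapped into
    [W]; injectivity of both charts identifies it with [(g, x)]. *)
Lemma act_nbhd cg c g0 x0 W : AG cg -> AM c -> cdom cg g0 -> cdom c x0 -> mopen AM W -> W (act g0 x0) ->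
  exists2 r : rat, 0 < r & forall g x, cdom cg g -> cdom c x ->
    cball (row_mx (cmap cg g0) (cmap c x0)) r (row_mx (cmap cg g) (cmap c x)) -> W (act g x).
Proof.
move=> Ag Ac gg cx oW Wx.
have [cont _] := act_analytic act_action.
have /(_ (prod_chart cg c)) := cont W oW.
have inprod : prod_atlas AG AM (prod_chart cg c) by exists cg, c.
move=> /(_ inprod (row_mx (cmap cg g0) (cmap c x0))) [|r r0 hr].
  by exists (g0, x0).
exists r => // g x cgg ccx /hr[[g' x'] [[/= cg' cx'] Wx']] /eq_row_mx[eg ex].
by rewrite -(mfd_inj G_manifold Ag cg' cgg eg) -(mfd_inj M_manifold Ac cx' ccx ex).
Qed.

Lemma act_open g W : mopen AM W -> mopen AM (act g @^-1` W).
Proof.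
move=> oW c Ac _ [x [cx Wx] <-].
have [cg Ag gg] := mfd_cover G_manifold g.
have [r r0 hr] := act_nbhd Ag Ac gg cx oW Wx.
have [s s0 hs] := chart_ball Ac cx (mopenT M_manifold) I.
exists (Num.min r s); first by rewrite lt_min r0.
move=> z hz; have [|y [cy _ e]] := hs z; first by apply: cball_le hz; rewrite ge_min lexx orbT.
exists y => //; split=> //=; apply: hr => // i.
rewrite -[i]splitK; case: (split i) => k /=; first by rewrite !row_mxEl subrr abs0 ltW.
rewrite !row_mxEr e; apply: le_trans (hz k) _; by rewrite ge_min lexx.
Qed.

Lemma act_chart cg c e g0 x0 k : AG cg -> AM c -> AM e -> cdom cg g0 -> cdom c x0 -> cdom e (act g0 x0) ->
  exists2 F : 'rV[K]_(cdim cg + cdim c) -> K,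
    forall g x, cdom cg g -> cdom c x -> cdom e (act g x) ->
      cmap e (act g x) 0 k = F (row_mx (cmap cg g) (cmap c x)) &
    analytic_at F (row_mx (cmap cg g0) (cmap c x0)).
Proof.
move=> Ag Ac Ae gg cx ex.
have [_ an] := act_analytic act_action.
have inprod : prod_atlas AG AM (prod_chart cg c) by exists cg, c.
have [F hF aF] := an (prod_chart cg c) e (g0, x0) inprod Ae (conj gg cx) ex k.
by exists F => // g x cgg ccx ee; apply: (hF (g, x)).
Qed.

Lemma analytic_row_mx m n (u : 'rV[K]_m) (x : 'rV[K]_n) i :
  analytic_at (fun z => row_mx u z 0 i) x.
Proof.
rewrite -[i]splitK; case: (split i) => k /=.
  by under eq_fun do rewrite row_mxEl; exact: analytic_const.
by under eq_fun do rewrite row_mxEr; exact: analytic_coord.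
Qed.

Lemma an_pt_act g f x : an_pt AM f (act g x) -> an_pt AM (fun y => f (act g y)) x.
Proof.
move=> af; have [cg Ag gg] := mfd_cover G_manifold g.
have [c Ac cx] := mfd_cover M_manifold x.
have [e Ae ex] := mfd_cover M_manifold (act g x).
have /choice[F hF] : forall k, exists F : 'rV[K]_(cdim cg + cdim c) -> K,
    (forall g x, cdom cg g -> cdom c x -> cdom e (act g x) ->
      cmap e (act g x) 0 k = F (row_mx (cmap cg g) (cmap c x))) /\
    analytic_at F (row_mx (cmap cg g) (cmap c x)).
  by move=> k; have [F] := act_chart k Ag Ac Ae gg cx ex; exists F.
pose H z : 'rV[K]_(cdim e) := \row_k F k (row_mx (cmap cg g) z).
have HE y : cdom c y -> cdom e (act g y) -> H (cmap c y) = cmap e (act g y).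
  by move=> cy ey; apply/rowP => k; rewrite mxE (hF k).1.
apply: (@an_pt_comp _ _ _ _ M_manifold c _ x (fun z => @cpull _ _ _ e f (H z)) Ac cx).
  apply: analytic_comp => [k|]; last by rewrite HE //; exact: af.
  under eq_fun do rewrite mxE; apply: analytic_comp => [i|]; last exact: (hF k).2.
  exact: analytic_row_mx.
exists (act g @^-1` cdom e); split=> // [|y ey cy].
  by apply: act_open; exact: mopen_cdom.
by rewrite HE // (cpullE M_manifold).
Qed.

Lemma analytic_on_act g U f : mopen AM U -> analytic_on AM (act g^-1%g @^-1` U) f ->
  analytic_on AM U (fun y => f (act g y)).
Proof.
move=> oU /(analytic_onE M_manifold _ (act_open oU)) af.
apply/(analytic_onE M_manifold _ oU) => x Ux; apply: an_pt_act; apply: af.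
by rewrite /preimage /= actK.
Qed.

Lemma np_act_axiom g xi : is_near_point AM (act g (np_base xi)) (act g^-1%g @^-1` np_dom xi)
  (fun f => np_hom xi (fun y => f (act g y))).
Proof.
have ax := np_axiom xi; have oU := np_open ax.
have an f := @analytic_on_act g (np_dom xi) f oU.
split.
- exact: act_open.
- by rewrite /preimage /= actK; exact: (np_mem ax).
- move=> f f' af af' ff; apply: (np_ext ax); [exact: an | exact: an | ].
  by move=> y Uy; apply: ff; rewrite /preimage /= actK.
- exact: (np_one ax).
- by move=> f f' af af'; apply: (np_add ax); exact: an.
- by move=> k f af; apply: (np_scale ax); exact: an.
- by move=> f f' af af'; apply: (np_mul ax); exact: an.
- by move=> f af; apply: (np_ev ax); exact: an.
Qed.

Definition np_act g xi : near_point := NearPoint (np_act_axiom g xi).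

Lemma np_act_induced g xi zeta : np_induced xi zeta -> np_induced (np_act g xi) (np_act g zeta).
Proof.
move=> [eb sub h]; split=> /= [|y|f af]; [by rewrite eb | exact: sub | ].
by apply: h; apply: analytic_on_act => //; exact: (np_open (np_axiom xi)).
Qed.

Lemma np_act_equiv g xi zeta : np_equiv xi zeta -> np_equiv (np_act g xi) (np_act g zeta).
Proof.
elim=> [x y h|x|x y _ ih|x y z _ ih _ ih'].
- by apply: rst_step; exact: np_act_induced.
- exact: rst_refl.
- exact: rst_sym.
- exact: rst_trans ih ih'.
Qed.

Definition wb_act g X : weil_bundle := wb_of (np_act g (wb_rep X)).

Lemma wb_act_class g X xi : wb_class X xi -> wb_class (wb_act g X) (np_act g xi).
Proof. by move=> h; apply: np_act_equiv; apply: wb_class_equiv h; exact: wb_repP. Qed.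

Lemma wb_proj_act g X : wb_proj (wb_act g X) = act g (wb_proj X).
Proof. by rewrite wb_proj_of. Qed.

Lemma wb_act1 X : wb_act 1%g X = X.
Proof.
apply: wb_eq (wb_act_class 1%g (wb_repP X)) _.
apply: wb_class_closed (wb_repP X) _; apply: rst_sym; apply: rst_step; split=> /= [|y|f af].
- by rewrite act1.
- by rewrite /preimage /= -[X in np_dom _ X -> _]act1 invg1.
- by congr np_hom; apply/funext => y; rewrite act1.
Qed.

Lemma wb_actM g h X : wb_act (g * h)%g X = wb_act g (wb_act h X).
Proof.
apply: wb_eq (wb_act_class (g * h)%g (wb_repP X)) _.
apply: wb_class_closed (wb_act_class g (wb_act_class h (wb_repP X))) _.
apply: rst_step; split=> /= [|y|f af].
- by rewrite actM.
- by rewrite /preimage /= invgM actM.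
- by congr np_hom; apply/funext => y; rewrite actM.
Qed.

Local Notation l := (\dim (fullv : {vspace A})).
Variable alpha : l.-tuple A.
Hypothesis alpha_basis : basis_of fullv alpha.
Local Notation wc := (wb_coord AM alpha).

Lemma wb_coord_act g d e X k : AM d -> AM e -> cdom d (wb_proj X) -> cdom e (act g (wb_proj X)) ->
  vA alpha (wc e (wb_act g X)) k =
  tay (vY alpha (wc d X)) (@cpull _ _ _ d (fun y => cmap e (act g y) 0 k)) (cmap d (wb_proj X)).
Proof.
move=> Ad Ae dx ex.
(* With a representative defined on the preimage of [cdom e], the translated near point lives inside
   [cdom e] and can be evaluated on the coordinates of [e]. *)
have oU := act_open (g := g) (mopen_cdom M_manifold Ae).
have := np_of_in p_prime M_manifold alpha_basis Ad dx oU ex.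
set xi := np_of _ _ _ _ _ _ _ => Xxi.
have ex' : cdom e (wb_proj (wb_act g X)) by rewrite wb_proj_act.
have [e1 t1] := wb_coordP p_prime M_manifold alpha_basis Ae ex'.
have sub : np_dom (np_act g xi) `<=` cdom e by move=> y /=; rewrite /preimage /= actVK.
have := t1 _ (wb_act_class g Xxi) _ (coord_on M_manifold k Ae sub (np_open (np_axiom (np_act g xi)))).
rewrite (tay_cpull_coord p_prime M_manifold _ k Ae (ex : cdom e (np_base (np_act g xi)))).
have -> : np_base (np_act g xi) = wb_proj (wb_act g X) by rewrite wb_proj_act.
have /rowP/(_ k) := e1; rewrite mxE => ->.
by rewrite /vY addrC subrK => <-.
Qed.

End Lift.

(** * Analyticity of the lifted action *)

Section AlgebraValued.
Variables (p : nat) (K : padicField p) (A : weilAlgebra K).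
Local Notation l := (\dim (fullv : {vspace A})).
Variable alpha : l.-tuple A.
Hypothesis alpha_basis : basis_of fullv alpha.
Variable n : nat.
Implicit Types (H : 'rV[K]_n -> A) (F : 'rV[K]_n -> K) (x : 'rV[K]_n).

Definition aan H x := forall j, analytic_at (fun z => coord alpha j (H z)) x.

Lemma aan_const (a : A) x : aan (fun=> a) x.
Proof. by move=> j; exact: analytic_const. Qed.

Lemma aanZ F H x : analytic_at F x -> aan H x -> aan (fun z => F z *: H z) x.
Proof.
move=> aF aH j; under eq_fun do rewrite linearZ /=; exact: analyticM.
Qed.

Lemma aan_sum (T : Type) (s : seq T) (H : T -> 'rV[K]_n -> A) x :
  (forall i, aan (H i) x) -> aan (fun z => \sum_(i <- s) H i z) x.
Proof.
move=> aH j; under eq_fun do rewrite linear_sum /=; apply: analytic_sum => i; exact: aH.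
Qed.

Lemma aanB H H' x : aan H x -> aan H' x -> aan (fun z => H z - H' z) x.
Proof.
move=> aH aH' j; have -> : (fun z => coord alpha j (H z - H' z)) =
    fun z => coord alpha j (H z) + -1 * coord alpha j (H' z).
  by apply/funext => z; rewrite linearB mulN1r.
by apply: analyticD => //; apply: analyticM => //; exact: analytic_const.
Qed.

(** In the basis [alpha] the product is bilinear with constant coefficients. *)
Lemma aanM H H' x : aan H x -> aan H' x -> aan (fun z => H z * H' z) x.
Proof.
move=> aH aH'.
have -> : (fun z => H z * H' z) = fun z => \sum_i \sum_j
    (coord alpha i (H z) * coord alpha j (H' z)) *: (tnth alpha i * tnth alpha j).
  apply/funext => z; rewrite {1}(sum_coord alpha_basis (H z)) {1}(sum_coord alpha_basis (H' z)).
  rewrite mulr_suml; apply: eq_bigr => i _; rewrite mulr_sumr; apply: eq_bigr => j _.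
  by rewrite -scalerAl -scalerAr scalerA.
apply: aan_sum => i; apply: aan_sum => j; apply: aanZ; last exact: aan_const.
exact: analyticM.
Qed.

Lemma aanX H x m : aan H x -> aan (fun z => H z ^+ m) x.
Proof.
move=> aH; elim: m => [|m ih]; first exact: aan_const.
by under eq_fun do rewrite exprS; apply: aanM.
Qed.

Lemma aan_prod (T : Type) (s : seq T) (H : T -> 'rV[K]_n -> A) x :
  (forall i, aan (H i) x) -> aan (fun z => \prod_(i <- s) H i z) x.
Proof.
move=> aH; elim: s => [|i s ih].
  by under eq_fun do rewrite big_nil; exact: aan_const.
have -> : (fun z => \prod_(j <- i :: s) H j z) = fun z => H i z * \prod_(j <- s) H j z.
  by apply/funext => z; rewrite big_cons.
exact: aanM.
Qed.

End AlgebraValued.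

Lemma analytic_nbhd p (K : padicField p) m n (F : 'I_m -> 'rV[K]_n -> K) x :
  (forall k, analytic_at (F k) x) ->
  exists2 r : rat, 0 < r & forall y, cball x r y -> forall k, analytic_at (F k) y.
Proof.
move=> aF.
have /choice[f hf] : forall k, exists r, 0 < r /\ forall y, cball x r y -> analytic_at (F k) y.
  move=> k; have /analyticP[r [c [r0 hr]]] := aF k; exists r; split=> // y.
  exact: expands_analytic r0 hr.
have [s s0 hs] := @min_pos _ (enum 'I_m) f (fun j => (hf j).1).
exists s => // y ys k; apply: (hf k).2; apply: cball_le ys; apply: hs; by rewrite mem_enum.
Qed.

Section LiftAnalytic.
Local Open Scope classical_set_scope.
Variables (p : nat) (K : padicField p) (M : Type) (AM : atlas K M).
Hypothesis p_prime : prime p.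
Hypothesis M_manifold : is_manifold AM.
Variable A : weilAlgebra K.
Variables (G : groupType) (AG : atlas K G).
Hypothesis G_manifold : is_manifold AG.
Variable act : G -> M -> M.
Hypothesis act_action : is_analytic_action AG AM act.
Local Notation l := (\dim (fullv : {vspace A})).
Variable alpha : l.-tuple A.
Hypothesis alpha_basis : basis_of fullv alpha.
Local Notation wc := (wb_coord AM alpha).
Local Notation weil_bundle := (weil_bundle AM A).
Local Notation actA := (wb_act M_manifold G_manifold act_action (A := A)).
Implicit Types (cg : chart K G) (c d e : chart K M) (x y : M) (g h : G) (X : weil_bundle).

Section Coord.
Variables (m n : nat).
Implicit Types P : 'rV[K]_(m + n * l).

(* A point P of the product chart is a pair (u, v) with v a matrix of Weil
   coordinates; pbase P is the point (u, base point of v) of G x M. *)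
Definition pmat P : 'M[K]_(n, l) := vec_mx (rsubmx P).
Definition pbase P : 'rV[K]_(m + n) := row_mx (lsubmx P) (vpr alpha (pmat P)).

Lemma pmat_row u (v : 'M[K]_(n, l)) : pmat (row_mx u (mxvec v)) = v.
Proof. by rewrite /pmat row_mxKr mxvecK. Qed.

Lemma pbase_row u (v : 'M[K]_(n, l)) : pbase (row_mx u (mxvec v)) = row_mx u (vpr alpha v).
Proof. by rewrite /pbase pmat_row row_mxKl. Qed.

Lemma analytic_pmat k j P : analytic_at (fun Q => pmat Q k j) P.
Proof.
have -> : (fun Q => pmat Q k j) = fun Q : 'rV[K]_(m + n * l) => Q 0 (rshift m (mxvec_index k j)).
  by apply/funext => Q; rewrite /pmat !mxE.
exact: analytic_coord.
Qed.

Lemma aan_vA k P : aan alpha (fun Q => vA alpha (pmat Q) k) P.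
Proof.
apply: aan_sum => j; apply: aanZ; [exact: analytic_pmat | exact: aan_const].
Qed.

Lemma analytic_pr k P : analytic_at (fun Q => wa_pr (vA alpha (pmat Q) k)) P.
Proof.
have -> : (fun Q => wa_pr (vA alpha (pmat Q) k)) = fun Q => \sum_j pmat Q k j * wa_pr (tnth alpha j).
  by apply/funext => Q; rewrite /vA wa_pr_sum.
apply: analytic_sum => j; apply: analyticM; [exact: analytic_pmat | exact: analytic_const].
Qed.

Lemma analytic_pbase i P : analytic_at (fun Q => pbase Q 0 i) P.
Proof.
rewrite -[i]splitK; case: (split i) => k /=.
  have -> : (fun Q => pbase Q 0 (lshift n k)) = fun Q : 'rV[K]_(m + n * l) => Q 0 (lshift (n * l) k).
    by apply/funext => Q; rewrite /pbase row_mxEl mxE.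
  exact: analytic_coord.
have -> : (fun Q => pbase Q 0 (rshift m k)) = fun Q => wa_pr (vA alpha (pmat Q) k).
  by apply/funext => Q; rewrite /pbase row_mxEr mxE.
exact: analytic_pr.
Qed.

Lemma aan_vY k P : aan alpha (fun Q => vY alpha (pmat Q) k) P.
Proof.
apply: aanB; first exact: aan_vA.
apply: aanZ; [exact: analytic_pr | exact: aan_const].
Qed.

Lemma aan_amon (a : mi n) P : aan alpha (fun Q => amon (vY alpha (pmat Q)) a) P.
Proof. by apply: (aan_prod alpha_basis) => k; apply: aanX => //; exact: aan_vY. Qed.

End Coord.

Definition wpt cg d g X : 'rV[K]_(cdim cg + cdim d * l) := row_mx (cmap cg g) (mxvec (wc d X)).

Lemma wpt_base cg d g X : AM d -> cdom d (wb_proj X) ->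
  pbase (wpt cg d g X) = row_mx (cmap cg g) (cmap d (wb_proj X)).
Proof.
by move=> Ad dx; rewrite pbase_row (wb_coordP p_prime M_manifold alpha_basis Ad dx).1.
Qed.

Lemma wb_act_local cg d e g0 X0 : AG cg -> AM d -> AM e ->
  cdom cg g0 -> cdom d (wb_proj X0) -> cdom e (act g0 (wb_proj X0)) ->
  exists Psi : 'rV[K]_(cdim cg + cdim d * l) -> 'rV[K]_(cdim e * l),
    (forall i, analytic_at (fun P => Psi P 0 i) (wpt cg d g0 X0)) /\
    exists2 s : rat, 0 < s & forall g X, cdom cg g -> cdom d (wb_proj X) ->
      cball (wpt cg d g0 X0) s (wpt cg d g X) ->
      cdom e (act g (wb_proj X)) /\ mxvec (wc e (actA g X)) = Psi (wpt cg d g X).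
Proof.
move=> Ag Ad Ae gg dx ex; set P0 := wpt _ _ _ _.
have b0 : pbase P0 = row_mx (cmap cg g0) (cmap d (wb_proj X0)) by exact: wpt_base.
have /choice[F hF] : forall k, exists F : 'rV[K]_(cdim cg + cdim d) -> K,
    (forall g x, cdom cg g -> cdom d x -> cdom e (act g x) ->
      cmap e (act g x) 0 k = F (row_mx (cmap cg g) (cmap d x))) /\ analytic_at F (pbase P0).
  by move=> k; have [F] := act_chart act_action k Ag Ad Ae gg dx ex; rewrite b0; exists F.
(* This is [tay] of the slice of [F k] at a fixed group element, with the slice coefficients written
   through [mslice] so that the group coordinates become analytic variables. *)
pose psi k P : A := \sum_(h : {ffun 'I_(cdim d) -> 'I_(wa_ord A)})
  tcoef (F k) (pbase P) (mslice (cdim cg) (mbox h)) *: amon (vY alpha (pmat P)) (mbox h).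
exists (fun P => mxvec (\matrix_(k, j) coord alpha j (psi k P))); split.
  move=> i; case/mxvec_indexP: i => k j.
  under eq_fun do rewrite mxvecE mxE.
  move: j; rewrite -/(aan alpha (psi k) P0); apply: aan_sum => h; apply: aanZ.
    apply: (@analytic_comp _ _ _ _ (fun z => tcoef (F k) z (mslice (cdim cg) (mbox h))) (@pbase _ _)).
      by move=> i; exact: analytic_pbase.
    by apply: tcoef_analytic => //; exact: (hF k).2.
  exact: aan_amon.
(* [r1] keeps each [F k] analytic at the base point, [r2] keeps the moved base point in the chart
   [e], and [s] pulls both conditions back along [pbase]. *)
have [r1 r10 hr1] := analytic_nbhd (fun k => (hF k).2).
have [r2 r20 hr2] := act_nbhd M_manifold G_manifold act_action Ag Ad gg dx (mopen_cdom M_manifold Ae) ex.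
have m0 : 0 < Num.min r1 r2 by rewrite lt_min r10.
have [s s0 hs] := analytic_continuous m0 (fun i => @analytic_pbase (cdim cg) (cdim d) i P0).
exists s => // g X cgg dX /hs; rewrite b0 wpt_base // => near.
have near2 : cball (row_mx (cmap cg g0) (cmap d (wb_proj X0))) r2 (row_mx (cmap cg g) (cmap d (wb_proj X))).
  by apply: cball_le near; rewrite ge_min lexx orbT.
have eX := hr2 g (wb_proj X) cgg dX near2; split=> //.
have near1 : cball (pbase P0) r1 (row_mx (cmap cg g) (cmap d (wb_proj X))).
  by rewrite b0; apply: cball_le near; rewrite ge_min lexx.
congr mxvec; apply: (vA_inj alpha_basis) => k.
have -> : vA alpha (\matrix_(k, j) coord alpha j (psi k (wpt cg d g X))) k = psi k (wpt cg d g X).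
  by rewrite [RHS](sum_coord alpha_basis); apply: eq_bigr => j _; rewrite mxE.
rewrite (wb_coord_act p_prime M_manifold G_manifold act_action alpha_basis k Ad Ae dX eX).
have oU := act_open M_manifold G_manifold act_action (g := g) (mopen_cdom M_manifold Ae).
have [t t0 ht] := chart_ball Ad dX oU eX.
have aFk := hr1 _ near1 k.
have aslice : analytic_at (fun z => F k (row_mx (cmap cg g) z)) (cmap d (wb_proj X)).
  by apply: analytic_comp => // i; exact: analytic_row_mx.
rewrite -(tay_local p_prime _ t0 _ aslice) => [|z /ht[y [dy ey <-]]]; last first.
  by rewrite (cpullE M_manifold) // (hF k).1.
rewrite /tay (tcoef_slice p_prime aFk) /psi wpt_base // pmat_row.
by [].
Qed.

(** Only the base point of [P] has to lie in the image of the charts; its nilpotent part is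
    arbitrary. *)
Lemma wpt_surj cg d g0 X0 : AG cg -> AM d -> cdom cg g0 -> cdom d (wb_proj X0) ->
  exists2 s : rat, 0 < s & forall P, cball (wpt cg d g0 X0) s P ->
    exists g X, [/\ cdom cg g, cdom d (wb_proj X) & wpt cg d g X = P].
Proof.
move=> Ag Ad gg dx.
have [r1 r10 hr1] := chart_ball Ag gg (mopenT G_manifold) I.
have [r2 r20 hr2] := chart_ball Ad dx (mopenT M_manifold) I.
have m0 : 0 < Num.min r1 r2 by rewrite lt_min r10.
have [s s0 hs] := analytic_continuous m0 (fun i => @analytic_pbase (cdim cg) (cdim d) i (wpt cg d g0 X0)).
exists s => // P /hs; rewrite wpt_base // => near.
have [|g [cgg _ eg]] := hr1 (lsubmx P).
  move=> i; have := near (lshift (cdim d) i); rewrite !row_mxEl => /le_trans; apply.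
  by rewrite ge_min lexx.
have [|x [ddx _ exx]] := hr2 (vpr alpha (pmat P)).
  move=> i; have := near (rshift (cdim cg) i); rewrite !row_mxEr => /le_trans; apply.
  by rewrite ge_min lexx orbT.
have [X [pX cX]] := wb_coord_surj p_prime M_manifold alpha_basis Ad ddx exx.
exists g, X; split=> //; first by rewrite pX.
by rewrite /wpt eg cX /pmat vec_mxK hsubmxK.
Qed.

Lemma wpt_inj cg d g X g' X' : AG cg -> AM d -> cdom cg g -> cdom cg g' ->
  cdom d (wb_proj X) -> cdom d (wb_proj X') -> wpt cg d g X = wpt cg d g' X' -> (g, X) = (g', X').
Proof.
move=> Ag Ad gg gg' dx dx' /eq_row_mx[eg /(can_inj mxvecK) eX].
congr (_, _); first exact: (mfd_inj G_manifold Ag gg gg' eg).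
exact: (wb_coord_inj p_prime M_manifold alpha_basis Ad dx dx' eX).
Qed.

Lemma wb_act_continuous :
  mcontinuous (prod_atlas AG (weil_atlas AM alpha)) (weil_atlas AM alpha)
    (fun z : G * weil_bundle => actA z.1 z.2).
Proof.
move=> W oW _ [cg [_ [Ag [d Ad <-] ->]]] _ [[g0 X0] [[/= gg dx] WX] <-].
have [e Ae ex] := mfd_cover M_manifold (act g0 (wb_proj X0)).
have [Psi [aPsi [s s0 hs]]] := wb_act_local Ag Ad Ae gg dx ex.
have [_ e0] := hs g0 X0 gg dx (cball_center _ (ltW s0)).
have inW : weil_atlas AM alpha (weil_chart AM alpha e) by exists e.
have imW : (@cmap _ _ _ (weil_chart AM alpha e) @` (cdom (weil_chart AM alpha e) `&` W))
    (mxvec (wc e (actA g0 X0))).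
  by exists (actA g0 X0) => //; split=> //=; rewrite /preimage /= wb_proj_act.
have [r r0 hr] := oW _ inW _ imW.
have [t t0 ht] := analytic_continuous r0 aPsi.
have [u u0 hu] := wpt_surj Ag Ad gg dx.
(* [s] is for the local formula, [t] for the continuity of [Psi], and [u] for realising every nearby
   [P] by a pair. *)
pose q := Num.min s (Num.min t u).
have q0 : 0 < q by rewrite !lt_min s0 t0 u0.
exists q => // P hP.
have [|g [X [cgg dX PE]]] := hu P; first by apply: cball_le hP; rewrite !ge_min lexx !orbT.
exists (g, X) => //; split=> //=.
have [|eX eq1] := hs g X cgg dX; first by rewrite PE; apply: cball_le hP; rewrite ge_min lexx.
have : cball (mxvec (wc e (actA g0 X0))) r (mxvec (wc e (actA g X))).
  rewrite e0 eq1; apply: ht; rewrite PE; apply: cball_le hP; by rewrite !ge_min lexx orbT.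
move=> /hr[Z [/= eZ WZ] /(can_inj mxvecK) eqZ].
suff -> : actA g X = Z by [].
apply: (wb_coord_inj p_prime M_manifold alpha_basis Ae) => //.
by rewrite wb_proj_act.
Qed.

Lemma wb_act_is_analytic :
  analytic_map (prod_atlas AG (weil_atlas AM alpha)) (weil_atlas AM alpha)
    (fun z : G * weil_bundle => actA z.1 z.2).
Proof.
split; first exact: wb_act_continuous.
move=> _ _ [g0 X0] [cg [_ [Ag [d Ad <-] ->]]] [e Ae <-] [/= gg dx] /=.
rewrite /preimage /= wb_proj_act => ex j.
have [Psi [aPsi [s s0 hs]]] := wb_act_local Ag Ad Ae gg dx ex.
(* [analytic_in_chart] asks for equality on the whole chart domain and not only near the point. So
   [Fn] is the true coordinate wherever [P] comes from a pair, and [Psi] elsewhere; on the ball of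
   radius [s] it is [Psi]. *)
pose Fn (P : 'rV[K]_(cdim cg + cdim d * l)) : K :=
  if pselect (exists z : G * weil_bundle,
    [/\ cdom cg z.1, cdom d (wb_proj z.2) & wpt cg d z.1 z.2 = P]) is left H
  then mxvec (wc e (actA (projT1 (cid H)).1 (projT1 (cid H)).2)) 0 j else Psi P 0 j.
have FnE g X : cdom cg g -> cdom d (wb_proj X) ->
    Fn (wpt cg d g X) = mxvec (wc e (actA g X)) 0 j.
  move=> cgg dX; rewrite /Fn; case: pselect => [H|]; last by case; exists (g, X).
  case: cid => -[g' X'] /= [cg' dX' E].
  by case: (wpt_inj Ag Ad cg' cgg dX' dX E) => -> ->.
exists Fn; first by move=> [g X] [/= cgg dX] _; rewrite -FnE.
apply: (@analytic_local _ _ _ (fun P => Psi P 0 j) _ _ s s0); last exact: aPsi.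
move=> P hP; rewrite /Fn; case: pselect => // H; case: cid => -[g X] /= [cgg dX PE].
by have [|_ ->] := hs g X cgg dX; rewrite PE.
Qed.

End LiftAnalytic.

Theorem mainTheorem7 (p : nat) (p_prime : prime p) (K : padicField p)
    (M : Type) (AM : atlas K M) (M_manifold : is_manifold AM)
    (A : weilAlgebra K)
    (alpha : (\dim (fullv : {vspace A})).-tuple A)
    (alpha_basis : basis_of fullv alpha) (alpha_1 : alpha`_0 = 1)
    (G : groupType) (AG : atlas K G) (G_lie : is_lie_group AG)
    (act : G -> M -> M) (act_action : is_analytic_action AG AM act) :
  exists actA : G -> weil_bundle AM A -> weil_bundle AM A,
    is_analytic_action AG (weil_atlas AM alpha) actA /\
    (forall (g : G) (X : weil_bundle AM A),
       wb_proj (actA g X) = act g (wb_proj X)).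
Proof.
have G_manifold := lie_manifold G_lie.
exists (wb_act M_manifold G_manifold act_action (A := A)); split; last exact: wb_proj_act.
split.
- exact: wb_act1.
- exact: wb_actM.
- exact: wb_act_is_analytic.
Qed.
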